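(* For any $\mathscr{B}\subseteq\mathbb{N}$, we have $h(X_\eta)\ge\overline{d}-\overline{d}^*$, where $\overline{d}=\overline{d}(\mathcal{F}_{\mathscr{B}})$ and $\overline{d}^*=\overline{d}(\mathcal{F}_{\mathscr{B}^*})$. If additionally $X_{\eta^*}$ is uniquely ergodic (in particular, if $\eta^*$ is a regular Toeplitz sequence), then $h(X_\eta)=\overline{d}-d^*$, where $d^*=d(\mathcal{F}_{\mathscr{B}^*})$.
   Context: $\mathbb{N}=\{1,2,\dots\}$. For $\mathscr{A}\subseteq\mathbb{N}$: $\mathcal{M}_{\mathscr{A}}=\bigcup_{a\in\mathscr{A}}a\mathbb{Z}$, $\mathcal{F}_{\mathscr{A}}=\mathbb{Z}\setminus\mathcal{M}_{\mathscr{A}}$, and $\mathscr{A}^{prim}$ is the set of those $a\in\mathscr{A}$ not divisible by any other element of $\mathscr{A}$. $\mathscr{B}^*=(\mathscr{B}\cup D)^{prim}$, where $D=\{d\in\mathbb{N}: d\mathcal{A}\subseteq\mathscr{B}\text{ for some infinite pairwise coprime set }\mathcal{A}\subseteq\mathbb{N}\}$. Put $\eta=\mathbf{1}_{\mathcal{F}_{\mathscr{B}}}$, $\eta^*=\mathbf{1}_{\mathcal{F}_{\mathscr{B}^*}}$ in $\{0,1\}^{\mathbb{Z}}$. For $x\in\{0,1\}^{\mathbb{Z}}$, $X_x$ is the closure of $\{\sigma^kx:k\in\mathbb{Z}\}$, $\sigma$ being the left shift. For $A\subseteq\mathbb{Z}$, $\overline{d}(A)=\limsup_{L\to\infty}\frac1L|A\cap[1,L]|$,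 and $d(A)=\lim_{L\to\infty}\frac1L|A\cap[1,L]|$ when the limit exists (it does for $\mathcal{F}_{\mathscr{B}^*}$ when $X_{\eta^*}$ is uniquely ergodic). For a subshift $X\subseteq\{0,1\}^{\mathbb{Z}}$, the topological entropy is $h(X)=\lim_{n\to\infty}\frac1n\log_2p_n(X)$, where $p_n(X)$ is the number of distinct blocks of length $n$ appearing in elements of $X$. $X$ is uniquely ergodic if it carries exactly one $\sigma$-invariant Borel probability measure. A sequence $x\in\{0,1\}^{\mathbb{Z}}$ is Toeplitz if for each $i\in\mathbb{Z}$ there is $s\in\mathbb{N}$ with $x(i+sk)=x(i)$ for all $k\in\mathbb{Z}$. Let $\mathrm{Per}(x,s)=\{i\in\mathbb{Z}: x(i+sk)=x(i)\text{ for all }k\in\mathbb{Z}\}$. A Toeplitz sequence $x$ is regular if $\lim_{r\to\infty}d\big(\bigcup_{s\le r}\mathrm{Per}(x,s)\big)=1$. (The sequence $\eta^*$ is always Toeplitz.) *)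

(* Defs.v *)
From HB Require Import structures.
From mathcomp Require Import all_boot all_order all_algebra.
From mathcomp Require Import all_classical all_reals all_analysis.

Set Implicit Arguments.
Unset Strict Implicit.
Unset Printing Implicit Defensive.

Import Order.TTheory GRing.Theory Num.Theory.
Import numFieldNormedType.Exports.

Local Open Scope classical_set_scope.
Local Open Scope ring_scope.

(* Subsets of N = {1, 2, ...} are terms [A : set nat] such that
   [forall a, A a -> (0 < a)%N]. *)

Definition multiples (A : set nat) : set int :=
  \bigcup_(a in A) range (fun k : int => a%:Z * k).

Definition free_integers (A : set nat) : set int := ~` multiples A.

Definition primitive (A : set nat) : set nat :=
  [set a | A a /\ forall b, A b -> (b %| a)%N -> b = a].

Definition pairwise_coprime (A : set nat) : Prop :=
  forall a b, A a -> A b -> a <> b -> coprime a b.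

Definition coprime_dilations (B : set nat) : set nat :=
  [set d | (0 < d)%N /\ exists A : set nat,
     [/\ forall a, A a -> (0 < a)%N, infinite_set A, pairwise_coprime A
       & [set (d * a)%N | a in A] `<=` B]].

Definition star (B : set nat) : set nat :=
  primitive (B `|` coprime_dilations B).

(* {0,1}^Z with the product of the discrete topologies *)
Definition full_shift : Type := {ptws int -> bool}.
HB.instance Definition _ := Pointed.on full_shift.
HB.instance Definition _ := Topological.on full_shift.

Definition eta (A : set nat) : full_shift := fun n : int => n \in free_integers A.

Definition shift_pow (k : int) (x : full_shift) : full_shift :=
  fun n : int => x (n + k).

Definition left_shift : full_shift -> full_shift := shift_pow 1.

Definition orbit_closure (x : full_shift) : set full_shift :=
  closure (range (fun k : int => shift_pow k x)).

Definition frequency (R : realType) (A : set int) (L : nat) : R :=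
  #|[pred i : 'I_L | (i.+1%:Z) \in A]|%:R / L%:R.

Definition upper_density (R : realType) (A : set int) : R :=
  limn_sup (frequency R A).

Definition has_density (R : realType) (A : set int) : Prop :=
  cvgn (frequency R A).

(* meaningful only under [has_density R A] *)
Definition density (R : realType) (A : set int) : R :=
  limn (frequency R A).

Definition appears (n : nat) (w : {ffun 'I_n -> bool}) (X : set full_shift) :
    Prop :=
  exists2 x, X x & exists i : int, forall k : 'I_n, w k = x (i + k%:Z).

Definition complexity (X : set full_shift) (n : nat) : nat :=
  #|[pred w : {ffun 'I_n -> bool} | `[< appears w X >]]|.

(* For a nonempty shift-invariant X the limit exists, since
   [complexity X] is submultiplicative. *)
Definition entropy (R : realType) (X : set full_shift) : R :=
  limn (fun n => (ln (complexity X n)%:R / ln 2) / n%:R : R).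

Definition borel_full_shift := g_sigma_algebraType (@open full_shift).

Definition shift_invariant (R : realType)
    (mu : probability borel_full_shift R) : Prop :=
  forall A : set borel_full_shift, measurable A -> mu (left_shift @^-1` A) = mu A.

(* A Borel probability measure on a closed X is encoded as one on the full
   shift giving X mass 1.  Uniqueness is agreement on Borel sets: the library's
   measures are functions on all sets, arbitrary off the sigma-algebra. *)
Definition uniquely_ergodic (R : realType) (X : set full_shift) : Prop :=
  exists mu : probability borel_full_shift R,
    [/\ shift_invariant mu, mu X = 1%E
      & forall nu : probability borel_full_shift R,
          shift_invariant nu -> nu X = 1%E ->
          forall A : set borel_full_shift, measurable A -> nu A = mu A].

Definition Per (x : full_shift) (s : nat) : set int :=
  [set i | forall k : int, x (i + s%:Z * k) = x i].

Definition toeplitz (x : full_shift) : Prop :=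
  forall i : int, exists2 s : nat, (0 < s)%N & Per x s i.

(* [density] is meaningful here: the union below is a periodic set. *)
Definition regular_toeplitz (R : realType) (x : full_shift) : Prop :=
  toeplitz x /\
  (fun r : nat => density R (\bigcup_(s in [set s | (0 < s <= r)%N]) Per x s))
    @ \oo --> (1 : R).

(* Main.v *)
From HB Require Import structures.
Require Import Defs.
From mathcomp Require Import all_boot all_order all_algebra.
From mathcomp Require Import all_classical all_reals all_analysis.
From mathcomp Require Import measurable_realfun ring lra zify.
Set Implicit Arguments.
Unset Strict Implicit.
Unset Printing Implicit Defensive.
Import Order.TTheory GRing.Theory Num.Theory.
Import numFieldNormedType.Exports.
Local Open Scope classical_set_scope.
Local Open Scope ring_scope.

(** Write [F_A] for the integers free of [A], and [C] for the union of [B] with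
    the set [D] of factors [d] such that [B] contains [d * a] for all [a] in an
    infinite pairwise coprime set; [star B] and [C] have the same multiples.

    Everything is measured by invariant means: finitely additive shift-invariant
    probabilities defined on all sets of integers, obtained as ultralimits of
    averages ([ultralimit_mean]).  They all agree on periodic sets, and when all of
    them agree on a set, its frequencies in long windows converge uniformly
    ([uniform_window]).

    The arithmetic input is the theorem of Davenport and Erdos: for a mean [m]
    coming from logarithmic averages, [m F_A] is the infimum of the densities of
    the periodic sets [free_integers (upto K A)], and equals the upper density of
    [F_A] ([davenport_erdos]).  It follows from Behrend's correlation inequality
    ([behrend]), applied to the two divisor-closed sets [F_A] and [1, x]
    ([log_sieve]).

    Lower bound.  An average over positions provides blocks of length [L], seen
    with positive mean, in which about [L] times the difference of the two upper
    densities is the number of ones at multiples of elements of [D].  Such ones can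
    be erased in any combination without disturbing the others
    ([erase_positions]): a one at a multiple of [d] is erased by a congruence
    modulo [a] for some large [a] with [d * a] in [B]; the elements of [B] sharing
    a prime with [a] cannot affect the remaining ones, and the conditions imposed
    by the other elements are independent of that congruence.  Hence the number of
    blocks of length [L] is at least [2] to that number ([complexity_lower]).

    Upper bound.  An invariant mean defines a shift-invariant probability on an
    orbit closure ([mean_invariant_measure]), so unique ergodicity makes all means
    agree on [F_C], whose frequencies are then uniform.  A long block of [eta B]
    is below the block of the periodic set [U = free_integers (upto K B)], and it
    is above that of [V = free_integers (upto K C)] up to a small proportion of
    positions, because it contains the ones of [eta (star B)], which are almost as
    frequent as those of [V] in every long window.  Only the coordinates in
    [U] minus [V] and these few exceptions are free ([complexity_upper],
    [entropy_upper]).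

    Regular Toeplitz sequences.  Outside a set of small mean, the visits of the
    orbit to an open and closed set depend on the position modulo a fixed period,
    so all means give them the same frequency ([regular_toeplitz_means]); uniform
    frequencies of visits determine every invariant measure
    ([uniquely_ergodic_of_means]). *)

(** * Invariant means *)

Definition translate (j : int) (E : set int) : set int := [set k | E (k + j)].

Definition invariant_mean (R : realType) (m : set int -> R) : Prop :=
  [/\ forall E, 0 <= m E, m setT = 1,
      forall E F, E `&` F = set0 -> m (E `|` F) = m E + m F
    & forall E, m (translate 1 E) = m E].

Lemma meanD (R : realType) (m : set int -> R) (E F : set int) :
  invariant_mean m -> m (E `&` F) + m (E `\` F) = m E.
Proof.
case=> _ _ mU _; rewrite -mU ?setUIDK //.
by rewrite setDE setIACA setICr setI0.
Qed.

Lemma mean_le (R : realType) (m : set int -> R) (E F : set int) :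
  invariant_mean m -> E `<=` F -> m E <= m F.
Proof.
move=> im EF; rewrite -(meanD F E im) setIC setIidl //.
by case: im => m0 _ _ _; rewrite lerDl.
Qed.

Lemma mean_setC (R : realType) (m : set int -> R) (E : set int) :
  invariant_mean m -> m (~` E) = 1 - m E.
Proof.
move=> im; have := meanD setT E im; rewrite setTI setTD.
by case: im => _ -> _ _ <-; ring.
Qed.

Lemma mean_setU_le (R : realType) (m : set int -> R) (E F : set int) :
  invariant_mean m -> m (E `|` F) <= m E + m F.
Proof.
move=> im; rewrite -(meanD (E `|` F) E im) (_ : (E `|` F) `&` E = E) ?lerD2l.
  by apply: mean_le => // k [[]].
by apply/setIidPr => k; left.
Qed.

Lemma mean_set0 (R : realType) (m : set int -> R) :
  invariant_mean m -> m set0 = 0.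
Proof.
by move=> im; rewrite -setCT mean_setC //; case: im => _ -> _ _; rewrite subrr.
Qed.

Lemma mean_nonempty (R : realType) (m : set int -> R) (E : set int) :
  invariant_mean m -> 0 < m E -> exists k, E k.
Proof.
move=> im mE; apply: contrapT => /forallNP E0; move: mE.
by rewrite (_ : E = set0) ?mean_set0 ?ltxx // -subset0 => k /E0.
Qed.

Lemma mean_bigU_le (R : realType) (m : set int -> R) (I : eqType) (s : seq I)
    (G : I -> set int) : invariant_mean m ->
  m [set k | exists2 i, i \in s & G i k] <= \sum_(i <- s) m (G i).
Proof.
move=> im; elim: s => [|i s IH].
  rewrite big_nil (_ : [set _ | _] = set0) ?mean_set0 //.
  by rewrite -subset0 => k [].
rewrite big_cons; apply: (le_trans _ (lerD (lexx _) IH)).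
apply: (le_trans _ (mean_setU_le _ _ im)); apply: mean_le => // k [j].
by rewrite inE => /orP[/eqP ->|js] Gk; [left|right; exists j].
Qed.

Lemma mean_partition (R : realType) (m : set int -> R) (I : finType)
    (f : int -> I) (E : set int) : invariant_mean m ->
  m E = \sum_i m (E `&` [set k | f k = i]).
Proof.
move=> im; have key (s : seq I) : uniq s ->
    m (E `&` [set k | f k \in s]) = \sum_(i <- s) m (E `&` [set k | f k = i]).
  elim: s => [_|i s IH /= /andP[nis us]].
    rewrite big_nil (_ : _ `&` _ = set0) ?mean_set0 //.
    by rewrite -subset0 => k [].
  have [_ _ mU _] := im; rewrite big_cons -IH // -mU.
    congr (m _); apply/seteqP; split => k /=.
      by rewrite inE => -[Ek /orP[/eqP|]]; [left|right].
    by rewrite inE => -[[Ek ->]|[Ek ->]]; rewrite ?eqxx ?orbT.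
  rewrite -subset0 => k /= [[_ fi] [_]].
  by rewrite fi (negbTE nis).
rewrite -[RHS](key _ (index_enum_uniq _)); congr (m _).
by apply/seteqP; split => [k Ek|k []//]; split => //=; rewrite mem_index_enum.
Qed.

Lemma mean_translate (R : realType) (m : set int -> R) (j : int) (E : set int) :
  invariant_mean m -> m (translate j E) = m E.
Proof.
move=> im; have trD i l F : translate i (translate l F) = translate (i + l) F.
  by apply/seteqP; split => k /=; rewrite /translate/= addrA.
have tr0 F : translate 0 F = F.
  by apply/seteqP; split => k /=; rewrite /translate/= addr0.
have nat_case (n : nat) F : m (translate n%:Z F) = m F.
  elim: n F => [F|n IH F]; first by rewrite tr0.
  by rewrite intS -trD; case: im => _ _ _ ->.
case: j => n; first exact: nat_case.
by rewrite NegzE -(nat_case n.+1 (translate _ _)) trD subrr tr0.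
Qed.

(** Limits along a free ultrafilter, which exist for all bounded sequences, turn
    asymptotically invariant averages into an exactly invariant mean. *)
Lemma ultralimit_mean (R : realType) (a : nat -> set int -> R) :
  (forall n E, 0 <= a n E) -> (forall n, a n setT = 1) ->
  (forall n E F, E `&` F = set0 -> a n (E `|` F) = a n E + a n F) ->
  (forall E, (fun n => a n (translate 1 E) - a n E) @ \oo --> (0 : R)) ->
  exists m : set int -> R, invariant_mean m /\
    forall E c, (\forall n \near \oo, c <= a n E) -> c <= m E.
Proof.
move=> a0 aT aU ainv.
have [G [uG ooG]] := @ultraFilterLemma nat \oo _.
have pG : ProperFilter G by case: uG.
have a1 n E : a n E <= 1.
  by rewrite -(aT n) -(setUv E) aU ?setICr // lerDl.
have cvgG E : exists l : R, (fun n => a n E) @ G --> l.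
  have cG : ((fun n => a n E) @ G) `[0, 1]%classic.
    by apply: (@filterE _ G) => n /=; rewrite in_itv/= a0 a1.
  have pF : ProperFilter ((fun n => a n E) @ G) by exact: fmap_proper_filter.
  have [p [_ cp]] := @segment_compact R 0 1 _ _ cG.
  exists p => A nA; rewrite /nbhs/=.
  have [//|nGA] := @in_ultra_setVsetC _ _ ((fun n => a n E) @^-1` A) uG.
  by have [x []] := cp (~` A) A nGA nA.
pose m E := lim ((fun n => a n E) @ G).
have mP E : (fun n => a n E) @ G --> m E.
  by have [l hl] := cvgG E; apply/cvg_ex; exists l.
exists m; split; last first.
  move=> E c cE; have GcE : G [set n | c <= a n E] by exact: ooG.
  exact: (limr_ge (mP E) GcE).
split.
- move=> E; apply: (limr_ge (mP E)); exact: (@filterE _ G).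
- apply: cvg_lim; first exact: norm_hausdorff.
  rewrite (_ : (fun n => _) = fun=> 1); first exact: cvg_cst.
  by apply/funext => n.
- move=> E F EF; apply: cvg_lim; first exact: norm_hausdorff.
  rewrite (_ : (fun n => _) = (fun n => a n E) \+ (fun n => a n F)).
    exact: (cvgD (mP E) (mP F)).
  by apply/funext => n; rewrite aU.
- move=> E; apply: cvg_lim; first exact: norm_hausdorff.
  rewrite (_ : (fun n => _) =
      (fun n => a n (translate 1 E) - a n E) \+ (fun n => a n E)).
    rewrite -[m E]add0r; apply: (cvgD _ (mP E)).
    by move=> A nA; apply: ooG; exact: (ainv E A nA).
  by apply/funext => n /=; rewrite subrK.
Qed.

Definition window_average (R : realType) (k : int) (L : nat) (E : set int) : R :=
  (\sum_(i < L) (k + i.+1%:Z \in E)%:R) / L%:R.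

Lemma in_translate (j k : int) (E : set int) :
  (k \in translate j E) = (k + j \in E).
Proof. by apply/idP/idP; rewrite !inE. Qed.

Lemma indicator_setU (R : realType) (E F : set int) (k : int) :
  E `&` F = set0 -> (k \in E `|` F)%:R = (k \in E)%:R + (k \in F)%:R :> R.
Proof.
move=> EF; rewrite in_setU; case: (boolP (k \in E)) => kE.
  case: (boolP (k \in F)) => kF; last by rewrite addr0.
  suff : set0 k by [].
  by rewrite -EF; split; exact/set_mem.
by rewrite add0r.
Qed.

Lemma window_average_ge0 (R : realType) k L E : 0 <= @window_average R k L E.
Proof. by rewrite divr_ge0 ?ler0n ?sumr_ge0 // => i _; rewrite ler0n. Qed.

(** Windows of growing length, wherever they are placed, produce a mean. *)
Lemma window_mean (R : realType) (k : nat -> int) (L : nat -> nat) :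
  (forall n, (n < L n)%N) ->
  exists m : set int -> R, invariant_mean m /\
    forall E c, (\forall n \near \oo, c <= window_average R (k n) (L n) E) ->
      c <= m E.
Proof.
move=> nL; have L0 n : (L n)%:R != 0 :> R.
  by rewrite pnatr_eq0 -lt0n (leq_trans _ (nL n)).
apply: ultralimit_mean => [n E|n|n E F EF|E].
- exact: window_average_ge0.
- rewrite /window_average (eq_bigr (fun=> 1)) ?sumr_const ?card_ord ?divff //.
  by move=> i _; rewrite in_setT.
- rewrite /window_average -mulrDl -big_split; congr (_ / _).
  by apply: eq_bigr => i _; exact: indicator_setU.
- apply/cvgrPdist_le => e e0; near=> n; rewrite sub0r normrN.
  rewrite /window_average -mulrBl.
  have -> : \sum_(i < L n) (k n + i.+1%:Z \in translate 1 E)%:R =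
      \sum_(i < L n) (k n + i.+2%:Z \in E)%:R :> R.
    by apply: eq_bigr => i _; rewrite in_translate -addrA -PoszD addn1.
  pose u i : R := (k n + i.+1%:Z \in E)%:R.
  have -> : \sum_(i < L n) (k n + i.+2%:Z \in E)%:R -
      \sum_(i < L n) (k n + i.+1%:Z \in E)%:R = u (L n) - u 0%N.
    rewrite -sumrB -(big_mkord xpredT (fun i => u i.+1 - u i)).
    by rewrite telescope_sumr.
  have u01 i : 0 <= u i <= 1 by rewrite ler0n lern1 leq_b1.
  rewrite normrM normfV (ger0_norm (ler0n _ _)) ler_pdivrMr; last first.
    by rewrite ltr0n (leq_trans _ (nL n)).
  apply: (@le_trans _ _ 1).
    by rewrite ler_norml; have := u01 (L n); have := u01 0%N; lra.
  apply: (@le_trans _ _ (e * n%:R)); last first.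
    by rewrite ler_wpM2l ?ler_nat ?(ltW e0) // ltnW.
  rewrite mulrC -ler_pdivrMr // mul1r.
  by near: n; exact: nbhs_infty_ger.
Unshelve. all: by end_near.
Qed.

(** Were the windows with a larger average arbitrarily long, they would produce
    a mean violating the bound. *)
Lemma uniform_window_le (R : realType) (E : set int) (c : R) :
  (forall m : set int -> R, invariant_mean m -> m E <= c) ->
  forall e, 0 < e -> exists L0, forall L k, (L0 <= L)%N ->
    window_average R k L E <= c + e.
Proof.
move=> mE e e0; apply: contrapT => /forallNP H.
have {}H n : exists kL : int * nat,
    (n < kL.2)%N /\ c + e <= window_average R kL.1 kL.2 E.
  have /existsNP[L /existsNP[k /not_implyP[nL /negP]]] := H n.+1.
  by rewrite -ltNge => h; exists (k, L); split => //; exact: ltW.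
have [kL kLP] := choice H.
have [|m [im mP]] := @window_mean R (fun n => (kL n).1) (fun n => (kL n).2).
  by move=> n; case: (kLP n).
have : c + e <= m E by apply: mP; apply: nearW => n; case: (kLP n).
by have := mE m im; lra.
Qed.

Lemma window_average_setC (R : realType) k L E : (0 < L)%N ->
  window_average R k L (~` E) = 1 - window_average R k L E.
Proof.
move=> L0; apply/eqP; rewrite eq_sym subr_eq /window_average -mulrDl -big_split/=.
rewrite (eq_bigr (fun=> 1)) ?sumr_const ?card_ord ?divff //.
  by rewrite pnatr_eq0 -lt0n.
move=> i _; rewrite -indicator_setU ?setICl //.
by rewrite setUC setUv in_setT.
Qed.

Lemma uniform_window (R : realType) (E : set int) (c : R) :
  (forall m : set int -> R, invariant_mean m -> m E = c) ->
  forall e, 0 < e -> exists L0, forall L k, (L0 <= L)%N ->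
    `|window_average R k L E - c| <= e.
Proof.
move=> mE e e0.
have [|L1 h1] := @uniform_window_le R E c _ e e0.
  by move=> m im; rewrite mE.
have [|L2 h2] := @uniform_window_le R (~` E) (1 - c) _ e e0.
  by move=> m im; rewrite mean_setC // mE.
exists (maxn 1 (maxn L1 L2)) => L k; rewrite !geq_max => /and3P[L0 le1 le2].
have := h1 _ k le1; have := h2 _ k le2; rewrite window_average_setC //.
by rewrite ler_norml; lra.
Qed.

(** * Periodic sets of integers *)

Definition periodic (Q : nat) (P : set int) : Prop :=
  forall k j : int, (Q%:Z %| j - k)%Z -> P k -> P j.

Lemma periodicC Q P : periodic Q P -> periodic Q (~` P).
Proof. by move=> h k j kj nk Pj; apply/nk/(h j) => //; rewrite -rpredN opprB. Qed.

Lemma periodicI Q P P' : periodic Q P -> periodic Q P' -> periodic Q (P `&` P').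
Proof. by move=> h h' k j kj [/(h _ _ kj) ? /(h' _ _ kj)]. Qed.

Lemma periodic_translate Q i P : periodic Q P -> periodic Q (translate i P).
Proof.
move=> h k j kj; apply: h; by rewrite opprD addrACA subrr addr0.
Qed.

Lemma periodic_dvdn Q Q' P : (Q %| Q')%N -> periodic Q P -> periodic Q' P.
Proof. by move=> QQ' h k j kj; apply: h; apply: dvdz_trans kj. Qed.

Lemma periodic_forall (I : Type) Q (P : I -> set int) (s : set I) :
  (forall i, s i -> periodic Q (P i)) ->
  periodic Q [set k | forall i, s i -> P i k].
Proof. by move=> h k j kj Pk i si; apply: (h i si k) => //; exact: Pk. Qed.

Lemma periodic_exists (I : Type) Q (P : I -> set int) (s : set I) :
  (forall i, s i -> periodic Q (P i)) -> periodic Q (\bigcup_(i in s) P i).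
Proof. by move=> h k j kj [i si Pk]; exists i => //; apply: (h i si k). Qed.

Definition residue (q : nat) (k : int) : 'I_q.+1 := inord `|(k %% q.+1)%Z|%N.

Lemma residueE q k : (residue q k)%:Z = (k %% q.+1)%Z.
Proof.
rewrite /residue inordK; first by rewrite gez0_abs // modz_ge0.
by rewrite -ltz_nat gez0_abs ?modz_ge0 // ltz_pmod.
Qed.

Lemma residue_eq q k j :
  (residue q k = residue q j) <-> (q.+1%:Z %| k - j)%Z.
Proof.
rewrite -eqz_mod_dvd; split => [e|/eqP e]; first by rewrite -!residueE e.
by apply/val_inj/eqP; rewrite -eqz_nat !residueE; apply/eqP.
Qed.

Lemma residue_ord q (i : 'I_q.+1) : residue q i%:Z = i.
Proof.
by apply/val_inj/eqP; rewrite -eqz_nat residueE modz_small //= ltz_nat.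
Qed.

Lemma residue_class q k (i : 'I_q.+1) :
  residue q k = i <-> (q.+1%:Z %| k - i%:Z)%Z.
Proof. by rewrite -{1}[i]residue_ord; exact: residue_eq. Qed.

(** Translating by multiples of [Q] preserves [P] and, when [Q] is coprime to
    [A], permutes the residue classes modulo [A] transitively; hence these
    classes cut [P] into [A] parts of equal mean. *)
Lemma mean_coprime_class (R : realType) (m : set int -> R) (P : set int)
    (Q A : nat) (r : int) : invariant_mean m -> periodic Q P -> (0 < A)%N ->
  coprime Q A -> m (P `&` [set k | (A%:Z %| k - r)%Z]) = m P / A%:R.
Proof.
move=> im pP; case: A => // A _ cQA.
have eqr r' : m (P `&` [set k | (A.+1%:Z %| k - r')%Z])
    = m (P `&` [set k | (A.+1%:Z %| k - r)%Z]).
  pose j := zchinese A.+1 Q (r - r') 0.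
  have cAQ : coprimez A.+1 Q by rewrite /coprimez /gcdz eqz_nat /= -/(coprime _ _) coprime_sym.
  have jA : (A.+1%:Z %| j - (r - r'))%Z.
    by rewrite -eqz_mod_dvd; apply/eqP; apply: zchinese_modl.
  have jQ : (Q%:Z %| j)%Z.
    by rewrite -[j]subr0 -eqz_mod_dvd; apply/eqP; apply: zchinese_modr.
  rewrite -(mean_translate j (_ `&` [set k | (_ %| k - r)%Z]) im); congr (m _).
  apply/seteqP; rewrite /translate; split => k [/= Pk dk]; split.
  - by apply: (pP k) => //; rewrite addrC addKr.
  - rewrite (_ : k + j - r = (k - r') + (j - (r - r'))); first exact: rpredD.
    by ring.
  - by apply: (pP (k + j)) => //; rewrite opprD addrA subrr sub0r rpredN.
  - move: dk; rewrite /= => dk.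
    rewrite (_ : k - r' = (k + j - r) - (j - (r - r'))); last by ring.
    by rewrite rpredB.
apply/eqP; rewrite eq_sym -subr_eq0 (mean_partition (residue A) P im).
rewrite (eq_bigr (fun=> m (P `&` [set k | (A.+1%:Z %| k - r)%Z]))); last first.
  move=> i _; rewrite -(eqr i%:Z); congr (m _).
  by apply/seteqP; split => k [Pk /=] /residue_class.
by rewrite sumr_const card_ord -[X in X / _]mulr_natr mulfK ?subrr // pnatr_eq0.
Qed.

Lemma mean_periodic (R : realType) (m : set int -> R) (P : set int) (Q : nat) :
  invariant_mean m -> (0 < Q)%N -> periodic Q P ->
  m P = (\sum_(i < Q) (i%:Z \in P)%:R) / Q%:R.
Proof.
move=> im; case: Q => // Q _ pP.
have m1 : m setT = 1 by case: im.
rewrite (mean_partition (residue Q) P im) mulr_suml; apply: eq_bigr => i _.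
have cl k := residue_class k i.
case: (boolP (i%:Z \in P)) => [/set_mem Pi|/negP Pi]; last first.
  rewrite mul0r (_ : _ `&` _ = set0) ?mean_set0 // -subset0 => k [Pk /cl dk].
  by apply: Pi; apply/mem_set/(pP k) => //; rewrite -rpredN opprB.
have /= := @mean_coprime_class R m setT 1 Q.+1 i%:Z im _ isT (coprime1n _).
rewrite m1 => <- //; congr (m _); apply/seteqP; split => k [Pk /=] => [/cl|] h; split => //=.
  exact: (pP i%:Z).
exact/cl.
Qed.

Lemma mean_periodic_uniq (R : realType) (m m' : set int -> R) (P : set int)
    (Q : nat) : invariant_mean m -> invariant_mean m' -> (0 < Q)%N ->
  periodic Q P -> m P = m' P.
Proof. by move=> im im' Q0 pP; rewrite !(mean_periodic _ Q0 pP). Qed.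

Lemma multiplesP (A : set nat) (k : int) :
  multiples A k <-> exists2 a, A a & (a%:Z %| k)%Z.
Proof.
split=> [[a Aa [j _ <-]]|[a Aa /dvdzP[j ->]]]; exists a => //.
  exact: dvdz_mulr.
by exists j => //; rewrite mulrC.
Qed.

Definition upto (K : nat) (A : set nat) : set nat := [set a | A a /\ (a <= K)%N].

Lemma multiplesS (A A' : set nat) : A `<=` A' -> multiples A `<=` multiples A'.
Proof. by move=> AA' k [a Aa h]; exists a => //; exact: AA'. Qed.

Lemma periodic_multiples (A : set nat) (Q : nat) :
  (forall a, A a -> (a %| Q)%N) -> periodic Q (multiples A).
Proof.
move=> AQ k j kj /multiplesP[a Aa ak]; apply/multiplesP; exists a => //.
rewrite -(subrK k j) rpredD // (dvdz_trans _ kj) //; exact: AQ.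
Qed.

Lemma periodic_free_upto (A : set nat) (K : nat) : (forall a, A a -> (0 < a)%N) ->
  periodic K`! (free_integers (upto K A)).
Proof.
move=> A0; apply: periodicC; apply: periodic_multiples => a [Aa aK].
by rewrite dvdn_fact // A0.
Qed.

(** * Behrend's inequality and the logarithmic sieve *)

Definition gcd_antitone (R : realType) (N : nat) (f : nat -> R) : Prop :=
  forall i j, (gcdn i N %| gcdn j N)%N -> f j <= f i.

Lemma gcd_antitone_gcd (R : realType) N (f : nat -> R) i j :
  gcd_antitone N f -> gcdn i N = gcdn j N -> f i = f j.
Proof. by move=> af ij; apply/eqP; rewrite eq_le !af // ij. Qed.

Lemma gcdn_dvd_coprime_mul q M i j : coprime q M ->
  (gcdn i q %| j)%N -> (gcdn i M %| j)%N ->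
  (gcdn i (q * M) %| gcdn j (q * M))%N.
Proof.
move=> cqM iq iM; rewrite dvdn_gcd dvdn_gcdr andbT.
apply: (@dvdn_trans (gcdn i q * gcdn i M)); last first.
  rewrite Gauss_dvd ?iq ?iM //.
  by apply: coprime_dvdl (dvdn_gcdr _ _) _; apply: coprime_dvdr (dvdn_gcdr _ _) _.
rewrite muln_gcdr dvdn_gcd; apply/andP; split.
  by rewrite dvdn_mull // dvdn_gcdl.
rewrite muln_gcdl dvdn_gcd dvdn_gcdr andbT.
by rewrite dvdn_mulr // dvdn_gcdl.
Qed.

Lemma sum_chinese (R : realType) q M (F : nat -> R) : coprime q M ->
  (0 < q)%N -> (0 < M)%N ->
  (forall i j, i = j %[mod q * M] -> F i = F j) ->
  \sum_(i < q * M) F i = \sum_(u < q) \sum_(v < M) F (chinese q M u v).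
Proof.
move=> cqM q0 M0 FE; have qM0 : (0 < q * M)%N by rewrite muln_gt0 q0.
rewrite pair_bigA /=.
pose h (uv : 'I_q * 'I_M) : 'I_(q * M) :=
  Ordinal (ltn_pmod (chinese q M uv.1 uv.2) qM0).
pose h' (i : 'I_(q * M)) : 'I_q * 'I_M :=
  (Ordinal (ltn_pmod i q0), Ordinal (ltn_pmod i M0)).
rewrite (reindex h) /=; first by apply: eq_bigr => uv _; apply: FE; rewrite modn_mod.
exists h' => [[u v] _|i _].
- rewrite /h' /h; congr (_, _); apply/ord_inj => /=.
    by rewrite modn_dvdm ?dvdn_mulr // chinese_modl // modn_small.
  by rewrite modn_dvdm ?dvdn_mull // chinese_modr // modn_small.
- by apply/ord_inj; rewrite /= -chinese_mod // modn_small.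
Qed.

Lemma chebyshev_sum (R : realType) (I : finType) (f g : I -> R) :
  (forall i j, 0 <= (f i - f j) * (g i - g j)) ->
  (\sum_i f i) * (\sum_i g i) <= #|I|%:R * \sum_i f i * g i.
Proof.
move=> fg.
have : 0 <= \sum_i \sum_j (f i - f j) * (g i - g j).
  by apply: sumr_ge0 => i _; apply: sumr_ge0 => j _.
have -> : \sum_i \sum_j (f i - f j) * (g i - g j) =
    \sum_i \sum_j (f i * g i + f j * g j - f i * g j - g i * f j).
  by apply: eq_bigr => i _; apply: eq_bigr => j _; ring.
rewrite (eq_bigr (fun i => #|I|%:R * (f i * g i) + \sum_j f j * g j
    - f i * \sum_j g j - g i * \sum_j f j)); last first.
  move=> i _; rewrite !big_split /= !sumrN sumr_const -!mulr_sumr.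
  by rewrite -[(_ * _) *+ _]mulr_natl.
rewrite !big_split /= !sumrN sumr_const -!mulr_sumr -!mulr_suml.
by rewrite -[(\sum_i _) *+ _]mulr_natl; lra.
Qed.

(** Functions that decrease when the gcd with [N] grows are positively correlated
    for the uniform measure on the residues modulo [N].  By the Chinese remainder
    theorem this reduces to prime powers, where divisibility of the gcds is a
    total preorder and the inequality is Chebyshev's. *)
Lemma behrend (R : realType) (N : nat) (f g : nat -> R) : (0 < N)%N ->
  gcd_antitone N f -> gcd_antitone N g ->
  (\sum_(i < N) f i) * (\sum_(i < N) g i) <= N%:R * \sum_(i < N) f i * g i.
Proof.
elim/ltn_ind: N f g => N IH f g N0 af ag.
have [N1|N1] := leqP N 1.
  have -> : N = 1%N by apply/eqP; rewrite eqn_leq N1.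
  by rewrite !big_ord1 mul1r.
pose p := pdiv N; have pp : prime p by exact: pdiv_prime.
pose q := (N`_p)%N; pose M := (N`_p^')%N.
have qM : (q * M)%N = N by rewrite partnC.
have cqM : coprime q M by exact: coprime_partC.
have q0 : (0 < q)%N by exact: part_gt0.
have M0 : (0 < M)%N by exact: part_gt0.
have qE : q = (p ^ logn p N)%N by rewrite /q p_part.
have lN : (0 < logn p N)%N by rewrite logn_gt0 mem_primes pp N0 pdiv_dvd.
have q1 : (1 < q)%N by rewrite qE -(exp1n (logn p N)) ltn_exp2r // prime_gt1.
have MN : (M < N)%N by rewrite -qM ltn_Pmull.
have anti i j : (gcdn i q %| j)%N -> (gcdn i M %| j)%N ->
    f j <= f i /\ g j <= g i.
  move=> h1 h2; split; [apply: af|apply: ag];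
    by rewrite -qM gcdn_dvd_coprime_mul.
have gmod (m i j : nat) : i = j %[mod m] -> gcdn i m = gcdn j m.
  by move=> ij; rewrite -(gcdn_modl i) ij gcdn_modl.
have fE i j : i = j %[mod q * M] -> f i = f j.
  by rewrite qM => /gmod; exact: gcd_antitone_gcd.
have gE i j : i = j %[mod q * M] -> g i = g j.
  by rewrite qM => /gmod; exact: gcd_antitone_gcd.
have fgE i j : i = j %[mod q * M] -> f i * g i = f j * g j.
  by move=> ij; rewrite (fE i j) // (gE i j).
have inner u : gcd_antitone M (fun v => f (chinese q M u v)) /\
    gcd_antitone M (fun v => g (chinese q M u v)).
  have key v v' : (gcdn v M %| gcdn v' M)%N ->
      f (chinese q M u v') <= f (chinese q M u v) /\
      g (chinese q M u v') <= g (chinese q M u v).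
    move=> vv'; apply: anti => //.
      rewrite (gmod q _ (chinese q M u v')) ?dvdn_gcdl //.
      by rewrite !chinese_modl.
    rewrite (gmod M _ v) ?chinese_modr // (dvdn_trans vv') //.
    by rewrite (gmod M _ (chinese q M u v')) ?dvdn_gcdl // chinese_modr.
  by split => v v' /key[].
have outer u u' v : (gcdn u q %| gcdn u' q)%N ->
    f (chinese q M u' v) <= f (chinese q M u v) /\
    g (chinese q M u' v) <= g (chinese q M u v).
  move=> uu'; apply: anti => //; last first.
    rewrite (gmod M _ (chinese q M u' v)) ?dvdn_gcdl //.
    by rewrite !chinese_modr.
  rewrite (gmod q _ u) ?chinese_modl // (dvdn_trans uu') //.
  by rewrite (gmod q _ (chinese q M u' v)) ?dvdn_gcdl // chinese_modl.
have tot u u' : (gcdn u q %| gcdn u' q)%N \/ (gcdn u' q %| gcdn u q)%N.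
  have [a _ ->] : exists2 a, (a <= logn p N)%N & gcdn u q = (p ^ a)%N.
    by apply/(dvdn_pfactor _ _ pp); rewrite -qE dvdn_gcdr.
  have [b _ ->] : exists2 b, (b <= logn p N)%N & gcdn u' q = (p ^ b)%N.
    by apply/(dvdn_pfactor _ _ pp); rewrite -qE dvdn_gcdr.
  by case/orP: (leq_total a b) => ?; [left|right]; apply: dvdn_exp2l.
rewrite -[in X in X <= _]qM -[in X in _ <= X]qM !sum_chinese //.
pose phi (u : 'I_q) := \sum_(v < M) f (chinese q M u v).
pose psi (u : 'I_q) := \sum_(v < M) g (chinese q M u v).
apply: (@le_trans _ _ (q%:R * \sum_u phi u * psi u)).
  have := @chebyshev_sum R 'I_q phi psi; rewrite card_ord; apply => u u'.
  have [uu'|uu'] := tot u u'.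
    by apply: mulr_ge0; rewrite subr_ge0; apply: ler_sum => v _;
       case: (outer _ _ v uu').
  rewrite -mulrNN; apply: mulr_ge0; rewrite opprB subr_ge0; by apply: ler_sum => v _;
     case: (outer _ _ v uu').
rewrite (sum_chinese cqM q0 M0 fgE) natrM -mulrA ler_wpM2l // mulr_sumr; apply: ler_sum => u _.
by have [a1 a2] := inner u; exact: (IH M MN _ _ M0 a1 a2).
Qed.

Lemma sum_nat_periodic (h : nat -> nat) (c T : nat) :
  (forall i, h (i + T)%N = h i) ->
  (\sum_(i < c * T) h i = c * \sum_(i < T) h i)%N.
Proof.
move=> hT; elim: c => [|c IH]; first by rewrite !mul0n big_ord0.
rewrite mulSn big_split_ord /= mulSn; congr (_ + _)%N.
by rewrite -IH; apply: eq_bigr => i _; rewrite addnC hT.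
Qed.

Lemma sum_nat_multiples (h : nat -> nat) (n k : nat) : (0 < n)%N ->
  (forall i, ~~ (n %| i) -> h i = 0)%N ->
  (\sum_(i < n * k) h i = \sum_(j < k) h (n * j))%N.
Proof.
move=> n0 hn; elim: k => [|k IH]; first by rewrite muln0 !big_ord0.
rewrite mulnSr big_split_ord /= IH big_ord_recr /=; congr (_ + _)%N.
case: n n0 hn {IH} => // n _ hn; rewrite big_ord_recl /= addn0 big1 ?addn0 //.
move=> i _; apply: hn; rewrite dvdn_addr ?dvdn_mulr //.
by rewrite gtnNdvd // /bump /= add1n ltnS.
Qed.

(** The residues [i] modulo [(x`!)^2] with [gcd (i, (x`!)^2) = n] are the
    multiples [n * j] with [j] coprime to [x`!]. *)
Lemma count_gcd_eq (x n : nat) : (0 < n <= x)%N ->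
  (n * \sum_(i < x`! * x`!) (gcdn i (x`! * x`!) == n) = x`! * totient x`!)%N.
Proof.
move=> /andP[n0 nx]; have f0 := fact_gt0 x.
have /dvdnP[c xc] : (n %| x`!)%N by rewrite dvdn_fact // n0.
have QE : (x`! * x`! = n * (c * x`!))%N by rewrite {1}xc -mulnA mulnCA.
have cc i : coprime i (c * x`!) = coprime i x`!.
  rewrite coprimeMr andb_idl // => h; apply: coprime_dvdr h.
  by rewrite xc dvdn_mulr.
rewrite QE (@sum_nat_multiples (fun i => gcdn i (n * (c * x`!)) == n)) //; last first.
  by move=> i ni; apply/eqP; rewrite eqb0; apply: contra ni => /eqP <-;
    rewrite dvdn_gcdl.
have cE (j : nat) : (gcdn (n * j) (n * (c * x`!)) == n) = coprime j x`!.
  by rewrite -muln_gcdr -[X in _ == X]muln1 eqn_pmul2l // -cc.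
under eq_bigr => j _ do rewrite cE.
rewrite (@sum_nat_periodic (fun i => nat_of_bool (coprime i x`!))); last first.
  by move=> i; rewrite -!(coprime_sym x`!) /coprime gcdnDr.
rewrite mulnA (mulnC n) -xc totient_count_coprime big_mkord.
by congr (_ * _)%N; apply: eq_bigr => i _; rewrite coprime_sym.
Qed.

Lemma gcd_sum (R : realType) (x : nat) (F : nat -> R) :
  let Q := (x`! * x`!)%N in
  \sum_(i < Q) (gcdn i Q <= x)%N%:R * F (gcdn i Q) =
  (x`! * totient x`!)%:R * \sum_(n < x) F n.+1 / n.+1%:R.
Proof.
move=> Q; have Q0 : (0 < Q)%N by rewrite muln_gt0 fact_gt0.
transitivity (\sum_(i < Q) \sum_(n < x) (gcdn i Q == n.+1)%:R * F n.+1).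
  apply: eq_bigr => i _; have g0 : (0 < gcdn i Q)%N by rewrite gcdn_gt0 Q0 orbT.
  have [gx|gx] := leqP (gcdn i Q) x; last first.
    rewrite mul0r big1 // => n _; case: eqP => [e|_]; last by rewrite mul0r.
    by move: gx; rewrite e ltnNge ltn_ord.
  have lx : ((gcdn i Q).-1 < x)%N by rewrite prednK.
  rewrite mul1r (bigD1 (Ordinal lx)) //= prednK // eqxx mul1r big1 ?addr0 //.
  move=> n nl; case: eqP => [e|_]; last by rewrite mul0r.
  by case/eqP: nl; apply/val_inj; rewrite /= e.
rewrite exchange_big mulr_sumr; apply: eq_bigr => n _ /=.
rewrite -mulr_suml -(@count_gcd_eq x n.+1) ?ltn_ord // natrM natr_sum.
by rewrite -/Q [n.+1%:R * _]mulrC mulrACA divff ?mulr1 // pnatr_eq0.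
Qed.

Lemma free_integersP (A : set nat) (k : int) :
  free_integers A k <-> forall a, A a -> ~~ (a%:Z %| k)%Z.
Proof.
split=> [h a Aa|h /multiplesP[a Aa]]; last exact/negP/h.
by apply/negP => ak; apply: h; apply/multiplesP; exists a.
Qed.

(** Behrend's inequality for two sets closed under divisors: the integers free of
    [C], and the integers up to [x]; the residues modulo [(x`!)^2] whose gcd with
    the modulus is [n <= x] have a proportion inversely proportional to [n]. *)
Lemma log_sieve (R : realType) (m : set int -> R) (C : set nat) (x : nat) :
  invariant_mean m -> (forall c, C c -> (0 < c)%N) ->
  m (free_integers (upto x C)) * (\sum_(n < x) n.+1%:R^-1) <=
  \sum_(n < x) (n.+1%:Z \in free_integers C)%:R / n.+1%:R.
Proof.
move=> im C0; set F := free_integers (upto x C).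
pose Q := (x`! * x`!)%N; have Q0 : (0 < Q)%N by rewrite muln_gt0 fact_gt0.
have cQ c : upto x C c -> (c %| Q)%N.
  by move=> [Cc cx]; rewrite dvdn_mulr // dvdn_fact // C0.
have pF : periodic Q F by apply: periodicC; exact: periodic_multiples.
pose f (i : nat) : R := (i%:Z \in F)%:R.
pose g (i : nat) : R := (gcdn i Q <= x)%N%:R.
have af : gcd_antitone Q f.
  move=> i j ij; rewrite /f; have [/set_mem/free_integersP jF|] := boolP (j%:Z \in F);
    last by rewrite ler0n.
  rewrite ler_nat; suff -> : i%:Z \in F by [].
  apply/mem_set/free_integersP => c Cc; apply: contra (jF c Cc); rewrite /= => ci.
  rewrite dvdzE /=; apply: (dvdn_trans _ (dvdn_gcdl _ Q)).
  by apply: dvdn_trans ij; rewrite dvdn_gcd cQ // andbT.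
have ag : gcd_antitone Q g.
  move=> i j ij; rewrite /g ler_nat; case: (leqP (gcdn j Q) x) => // jx.
  rewrite (leq_trans _ jx) //; apply: dvdn_leq ij.
  by rewrite gcdn_gt0 Q0 orbT.
have fg (i : nat) : f i = f (gcdn i Q).
  by apply: (gcd_antitone_gcd af); rewrite -gcdnA gcdnn.
have := behrend Q0 af ag.
have -> : \sum_(i < Q) g i = (x`! * totient x`!)%:R * \sum_(n < x) n.+1%:R^-1.
  have := @gcd_sum R x (fun=> 1); rewrite -/Q /=.
  under eq_bigr do rewrite mulr1.
  by move=> ->; congr (_ * _); apply: eq_bigr => n _; rewrite div1r.
have -> : \sum_(i < Q) f i * g i =
    (x`! * totient x`!)%:R * \sum_(n < x) f n.+1 / n.+1%:R.
  rewrite -gcd_sum -/Q; apply: eq_bigr => i _.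
  by rewrite fg mulrC.
have -> : \sum_(n < x) f n.+1 / n.+1%:R =
    \sum_(n < x) (n.+1%:Z \in free_integers C)%:R / n.+1%:R.
  apply: eq_bigr => n _; congr (_%:R / _); congr nat_of_bool.
  apply/idP/idP => /set_mem/free_integersP h; apply/mem_set/free_integersP => c.
    move=> Cc; have [cx|xc] := leqP c x; first exact: h.
    apply/negP => cn; have : (c <= n.+1)%N by exact: dvdn_leq.
    by rewrite leqNgt (leq_ltn_trans _ xc).
  by move=> [Cc _]; exact: h.
rewrite (mean_periodic im Q0 pF) -/f.
have W0 : 0 < (x`! * totient x`!)%:R :> R.
  by rewrite ltr0n muln_gt0 totient_gt0 fact_gt0.
have QR : 0 < Q%:R :> R by rewrite ltr0n.
have alg (s w h q : R) : q != 0 -> q * w * (s / q * h) = s * (w * h).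
  by move=> q0; field.
move=> h; rewrite -(ler_pM2l (mulr_gt0 QR W0)) alg ?gt_eqF //.
by rewrite -mulrA.
Qed.

(** * Logarithmic averages and the Davenport-Erdos theorem *)

Definition log_average (R : realType) (X : nat) (E : set int) : R :=
  (\sum_(n < X) (n.+1%:Z \in E)%:R / n.+1%:R) / \sum_(n < X) n.+1%:R^-1.

Lemma sum_inv_gt0 (R : realType) X : (0 < X)%N ->
  0 < \sum_(n < X) n.+1%:R^-1 :> R.
Proof.
case: X => // X _; rewrite big_ord_recl; apply: ltr_wpDr.
  by apply: sumr_ge0 => i _; rewrite invr_ge0 ler0n.
by rewrite invr_gt0 ltr0n.
Qed.

Lemma sum_inv_large (R : realType) (c : R) :
  \forall X \near \oo, c <= \sum_(n < X) n.+1%:R^-1.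
Proof.
have := @nondecreasing_dvgn_lt R (series harmonic) _ (@dvg_harmonic R).
have -> : series harmonic = fun X => \sum_(n < X) n.+1%:R^-1 :> R.
  by apply/funext => X; rewrite /series /= big_mkord.
move=> h; suff /cvgryPge : (fun X => \sum_(n < X) n.+1%:R^-1 : R) @ \oo --> +oo by apply.
apply: h; apply/nondecreasing_seqP => X; rewrite big_ord_recr /= lerDl.
by rewrite invr_ge0 ler0n.
Qed.

(** Summation by parts against the decreasing weights [1 / n]. *)
Lemma abel_bound (R : realType) (z : nat -> R) (M : R) X :
  (forall n, z n <= M) ->
  \sum_(n < X) (z n.+1 - z n) / n.+1%:R <= M - z 0%N.
Proof.
move=> zM; apply: (@le_trans _ _ (M - z 0%N - (M - z X) / X.+1%:R)); last first.
  by rewrite gerBl divr_ge0 ?subr_ge0.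
elim: X => [|X IH]; first by rewrite big_ord0 divr1 subrr.
rewrite big_ord_recr /=; apply: (le_trans (lerD IH (lexx _))).
rewrite -subr_ge0.
have -> : M - z 0%N - (M - z X.+1) / X.+2%:R -
    (M - z 0%N - (M - z X) / X.+1%:R + (z X.+1 - z X) / X.+1%:R) =
    (M - z X.+1) * (X.+1%:R^-1 - X.+2%:R^-1) by ring.
by rewrite mulr_ge0 // subr_ge0 // lef_pV2 ?posrE ?ltr0n // ler_nat.
Qed.

(** Shifting changes the numerators by a telescoping sum, which stays bounded
    while the sum of the weights diverges. *)
Lemma log_mean (R : realType) :
  exists m : set int -> R, invariant_mean m /\
    forall E c, (\forall n \near \oo, c <= log_average R n.+1 E) -> c <= m E.
Proof.
apply: ultralimit_mean => [n E|n|n E F EF|E].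
- by rewrite divr_ge0 ?sumr_ge0 // => i _; rewrite ?divr_ge0 ?invr_ge0 ?ler0n.
- rewrite /log_average (eq_bigr (fun i : 'I_n.+1 => i.+1%:R^-1)); last first.
    by move=> i _; rewrite in_setT div1r.
  by rewrite divff // gt_eqF // sum_inv_gt0.
- rewrite /log_average -mulrDl -big_split; congr (_ / _).
  by apply: eq_bigr => i _; rewrite indicator_setU //= mulrDl.
- apply/cvgrPdist_le => e e0.
  have h := sum_inv_large (e^-1).
  near=> n; rewrite sub0r normrN /log_average -mulrBl -sumrB.
  pose z i : R := (i.+1%:Z \in E)%:R.
  have -> : \sum_(i < n.+1) ((i.+1%:Z \in translate 1 E)%:R / i.+1%:R -
      (i.+1%:Z \in E)%:R / i.+1%:R) = \sum_(i < n.+1) (z i.+1 - z i) / i.+1%:R :> R.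
    by apply: eq_bigr => i _; rewrite in_translate -PoszD addn1 mulrBl.
  have z01 i : 0 <= z i <= 1 by rewrite ler0n lern1 leq_b1.
  have H0 : 0 < \sum_(i < n.+1) i.+1%:R^-1 :> R by exact: sum_inv_gt0.
  rewrite normrM normfV (gtr0_norm H0) ler_pdivrMr //.
  apply: (@le_trans _ _ 1).
    rewrite ler_norml; have := z01 0%N => /andP[z0 z1]; apply/andP; split; last first.
      apply: (le_trans (@abel_bound _ z 1 _ _)) => [i|]; last by rewrite gerBl.
      by case/andP: (z01 i).
    rewrite lerNl -sumrN.
    have -> : \sum_(i < n.+1) - ((z i.+1 - z i) / i.+1%:R) =
        \sum_(i < n.+1) (- z i.+1 - - z i) / i.+1%:R.
      by apply: eq_bigr => i _; rewrite -opprD mulNr.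
    apply: (le_trans (@abel_bound _ (fun i => - z i) 0 _ _)) => [i|].
      by rewrite oppr_le0; case/andP: (z01 i).
    by rewrite sub0r opprK.
  rewrite mulrC -ler_pdivrMr // div1r.
  near: n.
  case: h => N _ hN; exists N => // n /= Nn; apply: hN => /=.
  exact: leqW.
Unshelve. all: by end_near.
Qed.

(** The mean of [multiples C] is the limit of those of its finite stages.
    Ultralimits of the averages over [1, L] may fail this, as shown by the sets
    [C] of Besicovitch whose multiples have no density. *)
Definition sieve_continuous (R : realType) (m : set int -> R) : Prop :=
  forall C : set nat, (forall c, C c -> (0 < c)%N) -> forall e, 0 < e ->
    exists K, m (free_integers (upto K C)) <= m (free_integers C) + e.

Lemma frequency_window (R : realType) (E : set int) L :
  frequency R E L = window_average R 0 L E.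
Proof.
rewrite /frequency /window_average -sum1_card natr_sum; congr (_ / _).
rewrite big_mkcond; apply: eq_bigr => i _; rewrite add0r unfold_in /=.
by case: ifP.
Qed.

(** Logarithmic averages forget the beginning of the integers: summation by parts
    bounds them by the eventual frequencies. *)
Lemma log_average_le (R : realType) (E : set int) (c e : R) (N : nat) :
  0 <= c -> 0 < e -> (forall L, (N <= L)%N -> frequency R E L <= c) ->
  \forall X \near \oo, log_average R X.+1 E <= c + e.
Proof.
move=> c0 e0 hN; have h := sum_inv_large (N%:R / e).
near=> X.
have H0 : 0 < \sum_(i < X.+1) i.+1%:R^-1 :> R by exact: sum_inv_gt0.
rewrite /log_average ler_pdivrMr // mulrDl -lerBlDl.
pose z n : R := \sum_(i < n) (i.+1%:Z \in E)%:R - c * n%:R.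
apply: (@le_trans _ _ N%:R); last first.
  rewrite mulrC -ler_pdivrMr //; near: X.
  by case: h => M _ hM; exists M => // n /= Mn; apply: hM => /=; exact: leqW.
have -> : \sum_(n < X.+1) (n.+1%:Z \in E)%:R / n.+1%:R -
    c * \sum_(i < X.+1) i.+1%:R^-1 = \sum_(n < X.+1) (z n.+1 - z n) / n.+1%:R.
  rewrite mulr_sumr -sumrB; apply: eq_bigr => n _; rewrite -mulrBl; congr (_ / _).
  by rewrite /z big_ord_recr /= -natr1; ring.
apply: (le_trans (@abel_bound _ z N%:R _ _)) => [n|]; last first.
  by rewrite /z big_ord0 mulr0 subrr subr0.
rewrite /z; have [nN|Nn] := leqP n N.
  apply: (@le_trans _ _ n%:R); last by rewrite ler_nat.
  rewrite lerBlDr; apply: (@le_trans _ _ n%:R); last by rewrite lerDl mulr_ge0.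
  rewrite -[n in X in _ <= X]card_ord -sum1_card natr_sum; apply: ler_sum => i _.
  by rewrite lern1 leq_b1.
apply: (@le_trans _ _ 0); last by rewrite ler0n.
have n0 : 0 < n%:R :> R by rewrite ltr0n (leq_ltn_trans _ Nn).
rewrite subr_le0 -ler_pdivrMr //; have := hN n (ltnW Nn).
rewrite frequency_window /window_average.
by under eq_bigr do rewrite add0r.
Unshelve. all: by end_near.
Qed.

Lemma frequency_ge0 (R : realType) (E : set int) L : 0 <= frequency R E L.
Proof. by rewrite frequency_window window_average_ge0. Qed.

Lemma frequency_le1 (R : realType) (E : set int) L : frequency R E L <= 1.
Proof.
rewrite /frequency; case: L => [|L]; first by rewrite invr0 mulr0.
rewrite ler_pdivrMr ?ltr0n // mul1r ler_nat.
by rewrite -[X in (_ <= X)%N](card_ord L.+1) max_card.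
Qed.

Lemma upper_densityE (R : realType) (E : set int) :
  upper_density R E = inf (range (sups (frequency R E))).
Proof.
apply: limn_supE; exists 1; split; first exact: num_real.
move=> M M1 L _ /=; rewrite ger0_norm ?frequency_ge0 //.
by rewrite (le_trans (frequency_le1 _ _ _)) // ltW.
Qed.

Lemma sups_frequency (R : realType) (E : set int) n :
  has_sup (sdrop (frequency R E) n).
Proof.
split; first by exists (frequency R E n); exists n => /=.
by exists 1 => _ [L _ <-]; exact: frequency_le1.
Qed.

Lemma sups_frequency_ge0 (R : realType) (E : set int) n :
  0 <= sups (frequency R E) n.
Proof.
apply: (le_trans (frequency_ge0 R E n)).
apply: sup_ubound; first by case: (sups_frequency R E n).
by exists n => /=.
Qed.

Lemma upper_density_ge0 (R : realType) (E : set int) : 0 <= upper_density R E.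
Proof.
rewrite upper_densityE; apply: lb_le_inf; first by exists (sups (frequency R E) 0%N); exists 0%N.
by move=> _ [n _ <-]; exact: sups_frequency_ge0.
Qed.

Lemma upper_density_eventually (R : realType) (E : set int) (e : R) : 0 < e ->
  exists N, forall L, (N <= L)%N -> frequency R E L <= upper_density R E + e.
Proof.
move=> e0; rewrite upper_densityE.
have hi : has_inf (range (sups (frequency R E))).
  split; first by exists (sups (frequency R E) 0%N); exists 0%N.
  by exists 0 => _ [n _ <-]; exact: sups_frequency_ge0.
have [_ [N _ <-] hN] := inf_adherent e0 hi.
exists N => L NL; apply: le_trans (ltW hN).
apply: sup_ubound; first by case: (sups_frequency R E N).
by exists L.
Qed.

Lemma upper_density_frequently (R : realType) (E : set int) (e : R) (N : nat) :
  0 < e -> exists2 L, (N <= L)%N & upper_density R E - e <= frequency R E L.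
Proof.
move=> e0; have [_ [L /= NL <-] hL] := sup_adherent e0 (sups_frequency R E N).
exists L => //; apply: le_trans (ltW hL); rewrite lerD2r upper_densityE.
apply: ge_inf; last by exists N.
by exists 0 => _ [n _ <-]; exact: sups_frequency_ge0.
Qed.

Lemma mean_le_upper_density (R : realType) (m : set int -> R) (E : set int) :
  invariant_mean m ->
  (forall E c, (\forall n \near \oo, c <= log_average R n.+1 E) -> c <= m E) ->
  m E <= upper_density R E.
Proof.
move=> im hm; apply/ler_addgt0Pr => e e0.
have e2 : 0 < e / 2 by lra.
have [N hN] := @upper_density_eventually R E (e / 2) e2.
have c0 : 0 <= upper_density R E + e / 2.
  by rewrite addr_ge0 ?upper_density_ge0 // ltW.
have := log_average_le c0 e2 hN; rewrite -addrA -splitr => near_le.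
suff : 1 - (upper_density R E + e) <= m (~` E) by rewrite mean_setC //; lra.
apply: hm; apply: filterS near_le => n hn.
have H0 := @sum_inv_gt0 R n.+1 isT.
suff : log_average R n.+1 (~` E) = 1 - log_average R n.+1 E by move=> ->; lra.
apply/eqP; rewrite eq_sym subr_eq /log_average -mulrDl -big_split /=.
rewrite (eq_bigr (fun i : 'I_n.+1 => i.+1%:R^-1)); last first.
  move=> i _; rewrite -mulrDl -indicator_setU ?setICl //.
  by rewrite setUC setUv in_setT div1r.
by rewrite divff // gt_eqF // sum_inv_gt0.
Qed.

Lemma log_mean_sieve_continuous (R : realType) (m : set int -> R) :
  invariant_mean m ->
  (forall E c, (\forall n \near \oo, c <= log_average R n.+1 E) -> c <= m E) ->
  sieve_continuous m.
Proof.
move=> im hm C C0 e e0; apply: contrapT => /forallNP h.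
suff : m (free_integers C) + e <= m (free_integers C) by rewrite gerDl leNgt e0.
apply: hm; apply: nearW => n; rewrite /log_average ler_pdivlMr ?sum_inv_gt0 //.
apply: le_trans (log_sieve n.+1 im C0); apply: ler_wpM2r.
  by rewrite ltW // sum_inv_gt0.
by rewrite leNgt; apply/negP => /ltW; exact: h.
Qed.

Lemma upper_density_le_periodic (R : realType) (m : set int -> R) (E P : set int)
    (Q : nat) : invariant_mean m -> (0 < Q)%N -> periodic Q P -> E `<=` P ->
  upper_density R E <= m P.
Proof.
move=> im Q0 pP EP; apply/ler_addgt0Pr => e e0; have e2 : 0 < e / 2 by lra.
have [|N hN] := @uniform_window_le R P (m P) _ (e / 2) e2.
  by move=> m' im'; rewrite (mean_periodic_uniq im im' Q0 pP).
have [L NL hL] := @upper_density_frequently R E (e / 2) N e2.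
have : frequency R E L <= window_average R 0 L P.
  rewrite frequency_window ler_wpM2r ?invr_ge0 ?ler0n //; apply: ler_sum => i _.
  by rewrite ler_nat; case: (boolP (_ \in E)) => // /set_mem/EP/mem_set ->.
by have := hN L 0 NL; lra.
Qed.

(** The upper density of [free_integers C] is at most the density of each finite
    stage, and these densities decrease to the mean of [free_integers C], which
    in turn is at most the upper density. *)
Lemma davenport_erdos (R : realType) :
  exists m : set int -> R, [/\ invariant_mean m, sieve_continuous m
    & forall C, (forall c, C c -> (0 < c)%N) ->
        m (free_integers C) = upper_density R (free_integers C)].
Proof.
have [m [im hm]] := log_mean R.
have sm := log_mean_sieve_continuous im hm.
exists m; split => // C C0; apply/eqP; rewrite eq_le mean_le_upper_density //=.
apply/ler_addgt0Pr => e e0; have [K hK] := sm C C0 e e0.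
apply: le_trans hK; apply: (@upper_density_le_periodic _ m _ _ K`!) => //.
- exact: fact_gt0.
- exact: periodic_free_upto.
- by apply: subsetC; apply: multiplesS => c [].
Qed.

(** * Erasing ones from blocks *)

(** Each prime of [N] divides at most one element of [A]. *)
Lemma pairwise_coprime_avoid (A : set nat) (N : nat) :
  infinite_set A -> pairwise_coprime A -> (0 < N)%N ->
  exists2 a, A a & coprime a N.
Proof.
move=> infA cA N0; apply: contrapT => noa; apply: infA.
pose U (p : nat) := [set a | A a /\ (p %| a)%N].
have fU p : prime p -> finite_set (U p).
  move=> pp; have [[a [Aa pa]]|U0] := pselect (exists a, U p a); last first.
    rewrite (_ : U p = set0) // -subset0 => a Ua; apply: U0; by exists a.
  apply: (@sub_finite_set _ _ [set a]) => // b [Ab pb] /=; apply: contrapT => ba.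
  have := cA _ _ Ab Aa ba; rewrite /coprime => /eqP g1.
  have : (p %| gcdn b a)%N by rewrite dvdn_gcd pb pa.
  by rewrite g1 dvdn1 => /eqP p1; move: pp; rewrite p1.
apply: (@sub_finite_set _ _ (\bigcup_(p in [set` primes N]) U p)).
  move=> a Aa; have cN : ~~ coprime a N by apply/negP => h; apply: noa; exists a.
  have g1 : (1 < gcdn a N)%N.
    by rewrite ltn_neqAle eq_sym cN gcdn_gt0 N0 orbT.
  exists (pdiv (gcdn a N)) => /=.
    by rewrite mem_primes pdiv_prime // N0 (dvdn_trans (pdiv_dvd _)) // dvdn_gcdr.
  by split => //; rewrite (dvdn_trans (pdiv_dvd _)) // dvdn_gcdl.
apply: bigcup_finite; first exact: finite_seq.
by move=> p /=; rewrite mem_primes => /andP[pp _]; exact: fU.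
Qed.

(** Congruences modulo large elements of coprime sets force the positions of [S]
    into [multiples B], and every prime of the new modulus [A] is charged to a
    position of [S]. *)
Lemma erasing_class (B : set nat) (N : nat) (k0 : int) (S : seq nat) :
  (0 < N)%N ->
  (forall i, i \in S -> exists d, [/\ coprime_dilations B d, (d %| N)%N
      & (d%:Z %| k0 + i%:Z)%Z]) ->
  exists A : nat, exists r : int, [/\ (0 < A)%N, coprime N A,
    forall k, (A%:Z %| k - r)%Z -> (N%:Z %| k - k0)%Z ->
      forall i, i \in S -> multiples B (k + i%:Z)
  & forall p k, prime p -> (p %| A)%N -> (A%:Z %| k - r)%Z ->
      exists2 i, i \in S & (p%:Z %| k + i%:Z)%Z].
Proof.
move=> N0; elim: S => [|i S IH] hS.
  exists 1%N, 0; split => //; first exact: coprimen1.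
  by move=> p k pp; rewrite dvdn1 => /eqP p1; move: pp; rewrite p1.
have [|A [r [A0 cNA h1 h2]]] := IH.
  by move=> j jS; apply: hS; rewrite inE jS orbT.
have [|d [[d0 [Ai [Ai0 infA cA AB]]] dN dk]] := hS i; first by rewrite inE eqxx.
have [|a Aa caNA] := @pairwise_coprime_avoid Ai (N * A) infA cA.
  by rewrite muln_gt0 N0.
have [caN caA] : coprime a N /\ coprime a A by apply/andP; rewrite -coprimeMr.
have a0 := Ai0 a Aa.
have czaA : coprimez a A by rewrite /coprimez /gcdz eqz_nat.
pose r' := zchinese a A (- i%:Z) r.
have ra : (a%:Z %| r' + i%:Z)%Z.
  by rewrite -[i%:Z]opprK -eqz_mod_dvd; apply/eqP; exact: zchinese_modl.
have rA : (A%:Z %| r' - r)%Z.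
  by rewrite -eqz_mod_dvd; apply/eqP; exact: zchinese_modr.
have split_mod k : ((a * A)%N%:Z %| k - r')%Z ->
    (a%:Z %| k + i%:Z)%Z /\ (A%:Z %| k - r)%Z.
  move=> kr; split.
    rewrite -(subrK (r' + i%:Z) (k + i%:Z)) rpredD //.
    rewrite opprD addrACA subrr addr0; apply: dvdz_trans kr.
    by rewrite PoszM dvdz_mulr.
  rewrite -(subrK (r' - r) (k - r)) rpredD // opprB addrACA.
  rewrite (_ : k + r + (- r - r') = k - r'); last by ring.
  by apply: dvdz_trans kr; rewrite PoszM dvdz_mull.
exists (a * A)%N, r'; split.
- by rewrite muln_gt0 a0.
- by rewrite coprimeMr cNA andbT coprime_sym.
- move=> k /split_mod[ka kA] kN j; rewrite inE => /orP[/eqP ->|]; last exact: h1.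
  apply/multiplesP; exists (d * a)%N; first by apply: AB; exists a.
  have dk' : (d%:Z %| k + i%:Z)%Z.
    rewrite -(subrK (k0 + i%:Z) (k + i%:Z)) rpredD // opprD addrACA subrr addr0.
    by apply: dvdz_trans kN.
  rewrite PoszM Gauss_dvdz ?dk' //.
  rewrite /coprimez /gcdz eqz_nat; apply: coprime_dvdl dN _.
  by rewrite coprime_sym.
- move=> p k pp; rewrite Euclid_dvdM // => /orP[pa|pA] /split_mod[ka kA].
    by exists i; rewrite ?inE ?eqxx //; apply: dvdz_trans ka.
  by have [j jS pj] := h2 p k pp pA kA; exists j; rewrite // inE jS orbT.
Qed.

Lemma finite_stage_modulus (B' : set nat) (K A : nat) :
  (forall b, B' b -> (0 < b)%N) -> (forall b, B' b -> coprime b A) ->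
  exists2 Q, (0 < Q)%N & coprime Q A /\ forall b, upto K B' b -> (b %| Q)%N.
Proof.
move=> B0 cB; exists (\prod_(b < K.+1 | `[< B' b >]) b)%N.
  by rewrite prodn_cond_gt0 // => b /asboolP/B0.
split.
  by apply: (big_ind (fun x => coprime x A)); [exact: coprime1n|
    by move=> x y cx cy; rewrite coprimeMl cx|by move=> b /asboolP/cB].
move=> b [Bb bK]; have bK' : (b < K.+1)%N by rewrite ltnS.
rewrite (bigD1 (Ordinal bK')) /=; last exact/asboolP.
exact: dvdn_mulr.
Qed.

Lemma absz_sub_le (a b L : nat) :
  (a < L)%N -> (b < L)%N -> (`|(a%:Z - b%:Z)%R| <= L)%N.
Proof. by lia. Qed.

(** The elements of [B] that share a prime with the modulus [A] chosen to erase
    [S] divide no other position of the block, as such a prime would divide the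
    distance of two positions while being larger than the block.  The remaining
    elements of [B] are coprime to [A], so that their conditions are independent
    of the residue class modulo [A]. *)
Lemma erase_positions (R : realType) (m : set int -> R) (B : set nat)
    (L N : nat) (k0 : int) (T S : {set 'I_L}) :
  invariant_mean m -> sieve_continuous m -> (forall b, B b -> (0 < b)%N) ->
  (0 < N)%N -> (L`! %| N)%N ->
  (forall i, i \in S -> exists d, [/\ coprime_dilations B d, (d %| N)%N
      & (d%:Z %| k0 + i%:Z)%Z]) ->
  0 < m [set k | (N%:Z %| k - k0)%Z /\
                 forall i, i \in T -> free_integers B (k + i%:Z)] ->
  exists k, (forall i, i \in S -> multiples B (k + i%:Z)) /\
            (forall j, j \in T :\: S -> free_integers B (k + j%:Z)).
Proof.
move=> im sm B0 N0 LN hS; set E0 := (X in m X) => mE0.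
have [|A [r [A0 cNA h1 h2]]] :=
    @erasing_class B N k0 [seq nat_of_ord i | i <- enum S] N0.
  by move=> _ /mapP[i iS ->]; apply: hS; rewrite -mem_enum.
pose B' := [set b | B b /\ coprime b A].
have B'0 b : B' b -> (0 < b)%N by move=> [/B0].
have A0R : 0 < A%:R :> R by rewrite ltr0n.
(* each of the [L] positions will lose at most [e] to the elements of [B']
   beyond a finite stage *)
pose e := m E0 / A%:R / L.+1%:R.
have e0 : 0 < e by rewrite !divr_gt0 // ltr0n.
have [K hK] := sm B' B'0 e e0.
have [Q Q0 [cQA hQ]] := @finite_stage_modulus B' K A B'0 (fun b => @proj2 _ _).
pose FK := free_integers (upto K B'); pose F := free_integers B'.
pose EK := [set k | (N%:Z %| k - k0)%Z] `&`
  [set k | forall j, [set j | j \in T :\: S] j -> translate j%:Z FK k].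
have pFK : periodic Q FK by apply: periodicC; exact: periodic_multiples.
have pEK : periodic (N * Q) EK.
  apply: periodicI.
    apply: (@periodic_dvdn N); first exact: dvdn_mulr.
    by move=> k j kj /= Nk; rewrite -(subrK k j) -addrA rpredD.
  apply: (@periodic_dvdn Q); first exact: dvdn_mull.
  by apply: periodic_forall => j _; exact: periodic_translate.
have EK_ge : m E0 <= m EK.
  apply: mean_le => // k [Nk kT]; split => //= j jTS.
  apply/free_integersP => b [[Bb _] _].
  have jT : j \in T by move: jTS => /=; rewrite inE => /andP[].
  by have /free_integersP := kT j jT; exact.
pose cl := [set k : int | (A%:Z %| k - r)%Z].
have clE : m (EK `&` cl) = m EK / A%:R.
  apply: (@mean_coprime_class _ _ _ (N * Q)) => //.
  by rewrite coprimeMl cNA.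
pose bad := [set k | exists2 j : 'I_L, j \in enum 'I_L & translate j%:Z (FK `\` F) k].
have bad_le : m bad <= L%:R * e.
  apply: (le_trans (mean_bigU_le _ _ im)).
  rewrite (eq_bigr (fun=> m (FK `\` F))); last by move=> j _; rewrite mean_translate.
  rewrite big_const_seq count_predT size_enum_ord iter_addr_0 -[X in X <= _]mulr_natl.
  rewrite ler_wpM2l ?ler0n //.
  have FFK : F `<=` FK by apply: subsetC; apply: multiplesS => b [].
  by have := meanD FK F im; rewrite (setIidr FFK); move: hK; rewrite -/FK -/F; lra.
have [k [[[Nk kTS] kA] nbad]] : exists k, ((EK `&` cl) `\` bad) k.
  apply: (mean_nonempty im).
  have Le : L.+1%:R * e = m E0 / A%:R by rewrite mulrC divfK // pnatr_eq0.
  have : m E0 / A%:R <= m EK / A%:R by rewrite ler_wpM2r ?invr_ge0 ?ler0n.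
  have : m ((EK `&` cl) `&` bad) <= m bad by apply: mean_le => // j [].
  have := meanD (EK `&` cl) bad im; rewrite clE.
  by move: Le; rewrite -natr1 mulrDl mul1r; lra.
exists k; split => [i iS|j jTS].
  by apply: h1 => //; apply: map_f; rewrite mem_enum.
apply/free_integersP => b Bb; apply/negP => bkj.
have [cbA|ncbA] := boolP (coprime b A).
  have : F (k + j%:Z).
    apply: contrapT => nF; apply: nbad; exists j; first by rewrite mem_enum.
    by split => //; exact: kTS.
  by move=> /free_integersP /(_ b (conj Bb cbA)); rewrite bkj.
have g1 : (1 < gcdn b A)%N.
  by rewrite ltn_neqAle eq_sym ncbA gcdn_gt0 A0 orbT.
pose p := pdiv (gcdn b A); have pp : prime p by exact: pdiv_prime.
have pb : (p %| b)%N by rewrite (dvdn_trans (pdiv_dvd _)) // dvdn_gcdl.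
have pA : (p %| A)%N by rewrite (dvdn_trans (pdiv_dvd _)) // dvdn_gcdr.
have [_ /mapP[i iS ->] pki] := h2 p k pp pA kA.
have pij : (p%:Z %| i%:Z - j%:Z)%Z.
  rewrite (_ : i%:Z - j%:Z = (k + i%:Z) - (k + j%:Z)); last by ring.
  by rewrite rpredB // (dvdz_trans _ bkj).
have ij : i%:Z - j%:Z != 0.
  rewrite subr_eq0 eqz_nat; apply/eqP => /ord_inj eij.
  by move: jTS; rewrite inE -eij -mem_enum iS.
have pL : (p <= L)%N.
  have : (p <= `|(i%:Z - j%:Z)%R|)%N by apply: dvdn_leq; rewrite ?absz_gt0.
  by move=> /leq_trans; apply; exact: absz_sub_le (ltn_ord i) (ltn_ord j).
have : (p %| gcdn N A)%N.
  by rewrite dvdn_gcd pA andbT (dvdn_trans _ LN) // dvdn_fact // prime_gt0.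
by rewrite (eqP cNA) dvdn1 => /eqP p1; move: pp; rewrite p1.
Qed.

(** The sum on the left is the average, over the classes of [f], of the number of
    sets [G i] that contain the class. *)
Lemma mean_pigeonhole (R : realType) (m : set int -> R) (I : finType)
    (f : int -> I) (L : nat) (G : 'I_L -> set int) : invariant_mean m ->
  (forall i k k', f k = f k' -> G i k -> G i k') ->
  exists k0, 0 < m [set k | f k = f k0] /\
    \sum_i m (G i) <= #|[set i | k0 \in G i]%SET|%:R.
Proof.
move=> im fG; set s := \sum_i _; have [m0 m1 _ _] := im.
apply: contrapT => /forallNP no.
pose mt t := m [set k | f k = t].
pose gt t := \sum_i m (G i `&` [set k | f k = t]).
have sumg : \sum_t gt t = s.
  by rewrite exchange_big; apply: eq_bigr => i _; rewrite -mean_partition.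
have sumt : \sum_t mt t = 1.
  rewrite -m1 (mean_partition f _ im); apply: eq_bigr => t _.
  by rewrite setTI.
have lt t : 0 < mt t -> gt t < s * mt t.
  move=> mt0; have [k0 /= fk0] := mean_nonempty im mt0.
  have -> : gt t = #|[set i | k0 \in G i]%SET|%:R * mt t.
    rewrite -sum1_card natr_sum mulr_suml big_mkcond /=; apply: eq_bigr => i _.
    rewrite inE mul1r; case: ifPn => [/set_mem Gk0|/negP Gk0].
      congr (m _); apply/seteqP; split => k /= => [[]//|fk]; split => //.
      by apply: (fG i k0 k) => //; rewrite fk0.
    rewrite (_ : _ `&` _ = set0) ?mean_set0 // -subset0 => k [Gk /= fk].
    by apply: Gk0; apply/mem_set/(fG i k k0) => //; rewrite fk0.
  rewrite ltr_pM2r // ltNge; apply/negP => le; apply: (no k0).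
  by rewrite fk0.
have le t : 0 <= s * mt t - gt t.
  have [mt0|] := ltP 0 (mt t); first by rewrite subr_ge0 ltW // lt.
  move=> mt0; have mtE : mt t = 0 by apply/eqP; rewrite eq_le mt0 m0.
  rewrite mtE mulr0 sub0r oppr_ge0 sumr_le0 // => i _.
  by rewrite -mtE; apply: mean_le => // k [].
have : \sum_t (s * mt t - gt t) = 0 by rewrite sumrB -mulr_sumr sumt sumg mulr1 subrr.
move/psumr_eq0P => /(_ (fun t _ => le t)) z.
have : \sum_t mt t = 0.
  apply: big1 => t _; apply/eqP; rewrite eq_le m0 andbT leNgt; apply/negP => mt0.
  by have := lt t mt0; have := z t isT; lra.
by rewrite sumt => /eqP; rewrite oner_eq0.
Qed.

(** * Lower bound for the number of blocks *)

Lemma primitive_multiples (C : set nat) : (forall c, C c -> (0 < c)%N) ->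
  multiples (primitive C) = multiples C.
Proof.
move=> C0; apply/seteqP; split => [|k /multiplesP[c]].
  by apply: multiplesS => c [].
elim/ltn_ind: c => c IH Cc ck.
have [[b [Cb bc bnc]]|no] := pselect (exists b, [/\ C b, (b %| c)%N & b <> c]).
  apply: (IH b) => //; last by apply: dvdz_trans ck.
  by rewrite ltn_neqAle dvdn_leq ?C0 // andbT; apply/eqP.
apply/multiplesP; exists c => //; split => // b Cb bc.
by apply: contrapT => bnc; apply: no; exists b.
Qed.

Lemma star_union_gt0 (B : set nat) : (forall b, B b -> (0 < b)%N) ->
  forall c, (B `|` coprime_dilations B) c -> (0 < c)%N.
Proof. by move=> B0 c [/B0|[]]. Qed.

Lemma free_star (B : set nat) : (forall b, B b -> (0 < b)%N) ->
  free_integers (star B) = free_integers (B `|` coprime_dilations B).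
Proof.
by move=> B0; rewrite /free_integers primitive_multiples //; exact: star_union_gt0.
Qed.

Lemma eta_orbit_closure (B : set nat) k :
  orbit_closure (eta B) (shift_pow k (eta B)).
Proof. by apply: subset_closure; exists k. Qed.

(** Among the positions of ones in a block, those at multiples of a [d <= K] with
    [coprime_dilations B d] can be erased independently.  Their average number is
    [L] times the mean of the free integers of [B] that are multiples of such a
    [d], hence some block with positive mean has as many. *)
Lemma complexity_lower (R : realType) (B : set nat) (L : nat) (e : R) :
  (forall b, B b -> (0 < b)%N) -> 0 < e ->
  exists2 s : nat, (2 ^ s <= complexity (orbit_closure (eta B)) L)%N &
    L%:R * (upper_density R (free_integers B)
            - upper_density R (free_integers (star B)) - e) <= s%:R.
Proof.
move=> B0 e0; rewrite free_star //; set D := coprime_dilations B.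
have C0 := star_union_gt0 B0.
have [m [im sm mF]] := davenport_erdos R.
rewrite -!mF //; have [K hK] := sm _ C0 e e0.
pose FK := free_integers (upto K D); set F := free_integers B.
(* the factor [L`!] handles the primes up to [L], the factor [K`!] all [d <= K] *)
pose N := (L`! * K`!)%N.
have N0 : (0 < N)%N by rewrite muln_gt0 !fact_gt0.
have D0 d : D d -> (0 < d)%N by case.
have pFK : periodic N FK.
  by apply: (@periodic_dvdn K`!); [exact: dvdn_mull|exact: periodic_free_upto].
have clN k k' : residue N.-1 k = residue N.-1 k' <-> (N%:Z %| k - k')%Z.
  by rewrite residue_eq prednK.
pose f (k : int) := (residue N.-1 k, [set i : 'I_L | k + i%:Z \in F]%SET).
pose G (i : 'I_L) := translate i%:Z (F `\` FK).
have fG i k k' : f k = f k' -> G i k -> G i k'.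
  move=> [/clN kk' /setP/(_ i)]; rewrite !inE => eF [Fk nFKk]; split.
    by apply/set_mem; rewrite -eF; exact/mem_set.
  move=> FKk; apply: nFKk; apply: (pFK (k' + i%:Z)) => //.
  by rewrite opprD addrACA subrr addr0.
have [k0 [m0 hG]] := mean_pigeonhole im fG.
pose T := [set i : 'I_L | k0 + i%:Z \in F]%SET.
pose S := [set i | k0 \in G i]%SET.
have ST : S \subset T.
  by apply/fintype.subsetP => i; rewrite !inE => -[].
exists #|S|; last first.
  apply: le_trans hG; rewrite -[L in X in X <= _]card_ord -sum1_card natr_sum mulr_suml.
  apply: ler_sum => i _; rewrite mul1r mean_translate //.
  have sub : F `&` FK `<=` free_integers (upto K (B `|` D)).
    move=> k [/free_integersP h1 /free_integersP h2]; apply/free_integersP.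
    by move=> c [[Bc|Dc] cK]; [exact: h1|exact: h2].
  by have := mean_le im sub; have := meanD F FK im; lra.
have wit (U : {set 'I_L}) : exists k, U \subset S ->
    (forall i, i \in U -> multiples B (k + i%:Z)) /\
    (forall j, j \in T :\: U -> F (k + j%:Z)).
  have [US|/negP US] := boolP (U \subset S); last by exists 0.
  have [|i iU||k hk] := @erase_positions R m B L N k0 T U im sm B0 N0 _ _ _; last by exists k.
  - exact: dvdn_mulr.
  - have := fintype.subsetP US i iU; rewrite inE => /set_mem[_ /= nFK].
    have /multiplesP[d [Dd dK] dk] : multiples (upto K D) (k0 + i%:Z).
      by apply: contrapT.
    by exists d; split => //; rewrite dvdn_mull // dvdn_fact // D0.
  - apply: (lt_le_trans m0); apply: mean_le => // k /= [/clN kk0 /setP eT].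
    split => // i; rewrite inE => /set_mem Fi.
    by have := eT i; rewrite !inE (mem_set Fi) => /set_mem.
have [ks ksP] := choice wit.
pose w (U : {set 'I_L}) : {ffun 'I_L -> bool} := [ffun i : 'I_L => eta B (ks U + i%:Z)].
have wU (U : {set 'I_L}) i : U \subset S -> i \in T -> w U i = (i \notin U).
  move=> US iT; have [h1 h2] := ksP U US; rewrite ffunE /eta.
  case: (boolP (i \in U)) => iU /=.
    by apply/negP => /set_mem; apply; exact: h1.
  by apply/mem_set; apply: h2; rewrite inE iU.
rewrite -card_powerset -(card_in_imset (f := w)); last first.
  move=> U V; rewrite !inE => US VS /ffunP wUV; apply/setP => i.
  have [iT|iT] := boolP (i \in T).
    by apply/negb_inj; rewrite -!wU // wUV.
  have notin (W : {set 'I_L}) : W \subset S -> i \notin W.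
    by move=> WS; apply: contra iT => iW; rewrite (fintype.subsetP ST) // (fintype.subsetP WS).
  by rewrite (negbTE (notin U US)) (negbTE (notin V VS)).
apply: subset_leq_card; apply/fintype.subsetP => _ /imsetP[U _ ->].
rewrite unfold_in /=; apply/asboolP.
exists (shift_pow (ks U) (eta B)); first exact: eta_orbit_closure.
by exists 0 => i; rewrite ffunE /shift_pow add0r addrC.
Qed.

(** * Existence of the entropy *)

(** Fekete's lemma: the limit is the infimum of the quotients. *)
Lemma fekete (R : realType) (u : nat -> R) : (forall n, 0 <= u n) ->
  (forall m n, u (m + n)%N <= u m + u n) -> cvgn (fun n => u n / n%:R).
Proof.
move=> u0 uD; pose V := [set u n.+1 / n.+1%:R | n in [set: nat]].
have hV : has_inf V.
  split; first by exists (u 1%N / 1%:R); exists 0%N.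
  by exists 0 => _ [n _ <-]; rewrite divr_ge0.
apply/cvg_ex; exists (inf V); apply/cvgrPdist_le => e e0.
have e2 : 0 < e / 2 by lra.
have [_ [N _ <-] hN] := inf_adherent e2 hV.
pose M := \sum_(r < N.+1) u r.
have uM q r : u (q * N.+1 + r)%N <= q%:R * u N.+1 + u r.
  elim: q => [|q IH]; first by rewrite mul0n add0n mul0r add0r.
  rewrite mulSn -addnA (le_trans (uD _ _)) // (le_trans (lerD (lexx _) IH)) //.
  by rewrite -natr1 mulrDl mul1r; lra.
near=> n.
have n0 : (0 < n)%N by near: n; exists 1%N.
have n0R : 0 < n%:R :> R by rewrite ltr0n.
have lo : inf V <= u n / n%:R.
  by apply: ge_inf; [case: hV|exists n.-1; rewrite // prednK].
suff hi : u n / n%:R <= u N.+1 / N.+1%:R + e / 2.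
  by move: lo hi hN; move: (u n / _) (u N.+1 / _) (inf V) => a b c; rewrite ler_norml; lra.
rewrite ler_pdivrMr // mulrDl.
have h1 : (n %/ N.+1)%:R * u N.+1 <= u N.+1 / N.+1%:R * n%:R.
  rewrite -mulrA [X in _ <= X]mulrC ler_wpM2r ?u0 // [X in _ <= X]mulrC.
  by rewrite ler_pdivlMr ?ltr0n // -natrM ler_nat leq_trunc_div.
have h2 : u (n %% N.+1)%N <= M.
  have rN : (n %% N.+1 < N.+1)%N by rewrite ltn_pmod.
  by rewrite /M (bigD1 (Ordinal rN)) //= lerDl sumr_ge0.
have h3 : M <= e / 2 * n%:R.
  by rewrite mulrC -ler_pdivrMr //; near: n; exact: nbhs_infty_ger.
have := uM (n %/ N.+1)%N (n %% N.+1)%N; rewrite -divn_eq => /le_trans; apply.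
by rewrite lerD // (le_trans h2).
Unshelve. all: by end_near.
Qed.

Lemma complexityD (X : set full_shift) m n :
  (complexity X (m + n) <= complexity X m * complexity X n)%N.
Proof.
rewrite /complexity -cardX.
pose f (w : {ffun 'I_(m + n) -> bool}) : {ffun 'I_m -> bool} * {ffun 'I_n -> bool} :=
  ([ffun i => w (lshift n i)], [ffun i => w (rshift m i)]).
have injf : injective f.
  move=> v w [/ffunP vl /ffunP vr]; apply/ffunP => i.
  by case: (split_ordP i) => j ->; [have := vl j|have := vr j]; rewrite !ffunE.
rewrite -(fintype.card_image injf); apply: subset_leq_card; apply/fintype.subsetP => p.
move=> /fintype.imageP[w]; rewrite !unfold_in /= => /asboolP[x Xx [i wi]] ->.
apply/andP; split; apply/asboolP; exists x => //.
  by exists i => k; rewrite ffunE wi.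
by exists (i + m%:Z) => k; rewrite ffunE wi /= PoszD addrA.
Qed.

Lemma complexity_gt0 (X : set full_shift) n : X !=set0 -> (0 < complexity X n)%N.
Proof.
case=> x Xx; apply/card_gt0P; exists [ffun k : 'I_n => x (0 + k%:Z)].
rewrite unfold_in; apply/asboolP; exists x => //.
by exists 0 => k; rewrite ffunE.
Qed.

Lemma ln2_gt0 (R : realType) : 0 < ln 2 :> R.
Proof. by rewrite ln_gt0 // ltr1n. Qed.

Lemma entropy_cvg (R : realType) (X : set full_shift) : X !=set0 ->
  cvgn (fun n => ln (complexity X n)%:R / ln 2 / n%:R : R).
Proof.
move=> X0; apply: fekete => [n|m n].
  by rewrite divr_ge0 ?ln_ge0 ?ler1n ?complexity_gt0.
rewrite -mulrDl ler_wpM2r ?invr_ge0 ?(ltW (ln2_gt0 R)) //.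
rewrite -lnM ?posrE ?ltr0n ?complexity_gt0 // -natrM.
by rewrite ler_ln ?posrE ?ltr0n ?muln_gt0 ?complexity_gt0 // ler_nat complexityD.
Qed.

Lemma orbit_closure_nonempty (x : full_shift) : orbit_closure x !=set0.
Proof. by exists (shift_pow 0 x); apply: subset_closure; exists 0. Qed.

Lemma entropy_lower (R : realType) (B : set nat) :
  (forall b, B b -> (0 < b)%N) ->
  upper_density R (free_integers B) - upper_density R (free_integers (star B))
  <= entropy R (orbit_closure (eta B)).
Proof.
move=> B0; apply/ler_addgt0Pr => e e0; rewrite -lerBlDr.
apply: limr_ge; first exact/entropy_cvg/orbit_closure_nonempty.
near=> n; have n0 : (0 < n)%N by near: n; exists 1%N.
rewrite ler_pdivlMr ?ltr0n // ler_pdivlMr ?ln2_gt0 //.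
have [s hs hs'] := @complexity_lower R B n e B0 e0.
apply: (@le_trans _ _ (s%:R * ln 2)).
  by rewrite ler_wpM2r ?(ltW (ln2_gt0 R)) // mulrC.
rewrite mulr_natl -lnXn // -natrX ler_ln ?posrE ?ltr0n ?expn_gt0 //.
  by rewrite ler_nat.
exact/complexity_gt0/orbit_closure_nonempty.
Unshelve. all: by end_near.
Qed.

(** * Windows of coordinates generate the topology and the Borel sets *)

Definition agree (n : nat) (x y : full_shift) : Prop :=
  forall t : int, (`|t| <= n)%N -> x t = y t.

Definition window_set (n : nat) (C : set full_shift) : Prop :=
  forall x y, agree n x y -> C x -> C y.

Lemma agreeC n x y : agree n x y -> agree n y x.
Proof. by move=> h t tn; rewrite h. Qed.

Lemma agree_trans n x y z : agree n x y -> agree n y z -> agree n x z.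
Proof. by move=> h h' t tn; rewrite h // h'. Qed.

Lemma agree_le n n' x y : (n <= n')%N -> agree n' x y -> agree n x y.
Proof. by move=> nn' h t tn; apply: h; exact: leq_trans nn'. Qed.

Lemma window_setC n C : window_set n C -> window_set n (~` C).
Proof. by move=> wC x y xy nCx Cy; apply/nCx/(wC y x) => //; exact: agreeC. Qed.

Lemma window_set_shift n C k :
  window_set n C -> window_set (n + `|k|) (shift_pow k @^-1` C).
Proof.
by move=> wC x y xy; apply: wC => t tn; apply: xy; clear -tn; lia.
Qed.

Lemma nbhs_agree (x : full_shift) (U : set full_shift) :
  nbhs x U -> exists n, forall y, agree n x y -> U y.
Proof.
move=> xU.
pose F := filter_from [set: nat] (fun n => [set y : full_shift | agree n x y]).
have fF : Filter F.
  apply: filter_from_filter; first by exists 0%N.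
  move=> i j _ _; exists (maxn i j) => // y h; split; apply: agree_le h.
    exact: leq_maxl.
  exact: leq_maxr.
have cF : F --> (x : {ptws int -> bool}).
  apply/cvg_sup => t A [V [[W oW <-] Wx WA]].
  by exists `|t|%N => // y h; apply: WA; rewrite /= -(h t (leqnn _)).
by have [n _ h] := cF U xU; exists n.
Qed.

Lemma window_set_open n (C : set full_shift) : window_set n C -> open C.
Proof.
move=> wC; rewrite openE => x Cx; rewrite /interior.
have ev (t : int) : nbhs x [set y : full_shift | x t = y t].
  apply: (@proj_continuous int (fun=> bool) t x [set b | x t = b]).
  by rewrite nbhs_principalE; apply/principal_filterP.
have fx : Filter (nbhs x) by exact: nbhs_filter.
have hn : nbhs x [set y : full_shift |
    forall i, i \in iota 0 n.+1 -> x i%:Z = y i%:Z /\ x (- i%:Z) = y (- i%:Z)].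
  elim: (iota 0 n.+1) => [|i s IH].
    by apply: filterS filterT => y _ i; rewrite in_nil.
  have h := @filterI _ _ fx _ _ (@filterI _ _ fx _ _ (ev i%:Z) (ev (- i%:Z))) IH.
  apply: (@filterS _ _ fx _ _ _ h) => y [[h1 h2] h3] j; rewrite inE => /orP[/eqP -> //|].
  exact: h3.
apply: filterS hn => y h; apply: wC Cx => t tn.
have [h1 h2] : x (`|t|%N)%:Z = y (`|t|%N)%:Z /\ x (- (`|t|%N)%:Z) = y (- (`|t|%N)%:Z).
  by apply: h; rewrite mem_iota add0n ltnS.
by case: t tn h1 h2 => t _ //; rewrite NegzE abszN.
Qed.

Lemma orbit_closureP (x y : full_shift) :
  orbit_closure x y <-> forall n, exists k, agree n y (shift_pow k x).
Proof.
split=> [cy n|h U /nbhs_agree[n hU]].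
  have wn : window_set n [set z | agree n y z] by move=> z w zw yz; exact: agree_trans zw.
  have yn : nbhs y [set z | agree n y z].
    by apply: open_nbhs_nbhs; split => //; exact: window_set_open wn.
  by have [_ [[k _ <-] h]] := cy _ yn; exists k.
by have [k hk] := h n; exists (shift_pow k x); split; [exists k|exact: hU].
Qed.

Definition window_sets : set (set full_shift) :=
  [set C | exists n, window_set n C].

Lemma open_bigcup_window (U : set full_shift) : open U ->
  U = \bigcup_n [set x | forall y, agree n x y -> U y].
Proof.
move=> oU; apply/seteqP; split => [x Ux|x [n _]]; last by apply.
have [|n hn] := @nbhs_agree x U; first by apply: open_nbhs_nbhs.
by exists n.
Qed.

(** Every open set is a countable union of window sets. *)
Lemma borel_window_sets :
  (@measurable _ borel_full_shift : set (set full_shift)) = <<s window_sets >>.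
Proof.
apply/seteqP; split; apply: smallest_sub; [exact: smallest_sigma_algebra| |
  exact: smallest_sigma_algebra|].
- move=> U oU; rewrite (open_bigcup_window oU).
  apply: (@sigma_algebra_bigcup _ setT window_sets) => n.
  apply: sub_sigma_algebra; exists n => x y xy h z yz; apply: h.
  exact: agree_trans yz.
- move=> C [n wC]; apply: sub_sigma_algebra; exact: window_set_open wC.
Qed.

Lemma measurable_window_set n C :
  window_set n C -> measurable (C : set borel_full_shift).
Proof. by move=> wC; rewrite borel_window_sets; apply: sub_sigma_algebra; exists n. Qed.

Lemma probability_window_uniq (R : realType)
    (mu nu : probability borel_full_shift R) :
  (forall n C, window_set n C -> mu C = nu C) ->
  forall A : set borel_full_shift, measurable A -> mu A = nu A.
Proof.
move=> h A; rewrite borel_window_sets => mA.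
apply: (@g_sigma_algebra_measure_unique _ R borel_full_shift window_sets _
   (fun=> setT) _ _ mu nu _ _ _ A mA).
- by move=> C [n wC]; exact: measurable_window_set wC.
- by move=> _; exists 0%N.
- by apply/seteqP; split => // x _; exists 0%N.
- move=> C C' [n wC] [n' wC']; exists (maxn n n') => x y xy [Cx C'x]; split.
    by apply: wC Cx; apply: agree_le xy; exact: leq_maxl.
  by apply: wC' C'x; apply: agree_le xy; exact: leq_maxr.
- by move=> C [n wC]; exact: h wC.
- move=> _; rewrite [X in (X < _)%E](_ : _ = 1%E) ?ltry //.
  exact: probability_setT.
Qed.

(** * The shift-invariant measure of a mean *)

(** The total weight of the words of the length of [w] that precede [w] in the
    lexicographic order. *)
Definition coin_lower (R : realType) (q : seq bool -> R) (w : seq bool) : R :=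
  \sum_(j < size w) (if nth false w j then q (rcons (take j w) false) else 0).

Lemma coin_lower_rcons (R : realType) (q : seq bool -> R) w b :
  coin_lower q (rcons w b) =
  coin_lower q w + if b then q (rcons w false) else 0.
Proof.
rewrite /coin_lower size_rcons big_ord_recr /= nth_rcons ltnn eqxx.
rewrite -cats1 take_size_cat //; congr (_ + _); apply: eq_bigr => j _.
by rewrite nth_cat ltn_ord take_cat ltn_ord.
Qed.

(** Consistent weights [q] on words are the probabilities of the initial words
    of a measurable sequence of bits on the unit interval: the words of each
    length cut it into consecutive pieces of lengths [q]. *)
Lemma coin_tossing (R : realType) (q : seq bool -> R) :
  q [::] = 1 -> (forall w, 0 <= q w) ->
  (forall w, q w = q (rcons w false) + q (rcons w true)) ->
  exists f : R -> nat -> bool, forall w,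
    measurable [set t : R | mkseq (f t) (size w) = w] /\
    lebesgue_measure (`[0, 1[%classic `&` [set t : R | mkseq (f t) (size w) = w])
      = (q w)%:E.
Proof.
move=> q1 q0 qD.
pose next (t : R) (w : seq bool) :=
  rcons w (coin_lower q w + q (rcons w false) <= t).
pose pre t n := iter n (next t) [::].
pose f t n := coin_lower q (pre t n) + q (rcons (pre t n) false) <= t.
have preE t n : mkseq (f t) n = pre t n.
  by elim: n => //= n IH; rewrite mkseqS IH.
have rc t w b : (mkseq (f t) (size (rcons w b)) = rcons w b) <->
    mkseq (f t) (size w) = w /\ (coin_lower q w + q (rcons w false) <= t) = b.
  rewrite size_rcons mkseqS; split=> [/rcons_inj[e <-]|[e <-]].
    by split => //; rewrite /f -preE e.
  by rewrite {2}/f -preE e.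
have itv w : 0 <= coin_lower q w /\ coin_lower q w + q w <= 1.
  elim/last_ind: w => [|w b [h1 h2]].
    by rewrite /coin_lower big_ord0 q1 add0r.
  rewrite coin_lower_rcons; have := qD w; have := q0 (rcons w false).
  by have := q0 (rcons w true); case: b; lra.
exists f => w; split.
  elim/last_ind: w => [|w b IH].
    by rewrite (_ : [set _ | _] = setT) //; apply/seteqP; split.
  rewrite (_ : [set _ | _] = [set t | mkseq (f t) (size w) = w] `&`
      (if b then `[coin_lower q w + q (rcons w false), +oo[%classic
       else `]-oo, coin_lower q w + q (rcons w false)[%classic)); last first.
    apply/seteqP; split => t /=.
      by move=> /rc[e1 e2]; split => //; case: b e2; rewrite /= in_itv /= ?andbT // ltNge => ->.
    move=> [e1 e2]; apply/rc; split => //; move: e2; case: b; rewrite /= in_itv /= ?andbT //.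
    by rewrite ltNge => /negbTE.
  by apply: measurableI => //; case: b.
have -> : `[0, 1[%classic `&` [set t : R | mkseq (f t) (size w) = w] =
    `[coin_lower q w, coin_lower q w + q w[%classic.
  elim/last_ind: w => [|w b IH].
    apply/seteqP; rewrite /coin_lower big_ord0 q1 add0r.
    by split => [t []//|t h]; split.
  have := qD w; have := q0 (rcons w false); have := q0 (rcons w true) => h1 h2 h3.
  apply/seteqP; rewrite coin_lower_rcons; split => t /=.
    move=> [t01 /rc[e1 e2]].
    have : (`[0, 1[%classic `&` [set t : R | mkseq (f t) (size w) = w]) t by split.
    rewrite IH /= !in_itv /= => /andP[lo hi].
    by case: b e2 => e2; apply/andP; split; move/negbT: e2 || idtac; rewrite -?ltNge; lra.
  rewrite in_itv /= => /andP[lo hi].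
  have : (`[coin_lower q w, coin_lower q w + q w[%classic) t.
    by rewrite /= in_itv /=; apply/andP; case: b lo hi; split; lra.
  rewrite -IH => -[t01 e1]; split => //; apply/rc; split => //.
  case: b lo hi => lo hi; first by lra.
  by apply/negbTE; rewrite -ltNge; lra.
rewrite lebesgue_measure_itv /= lte_fin ltrDl.
case: ltP => [_|q00]; first by rewrite -EFinD addrAC subrr add0r.
by congr (_%:E); apply/eqP; rewrite eq_le q0 q00.
Qed.

(** The coordinates in the window of radius [n] come among the first [2 * n + 2]
    ones, see [int_index_window]. *)
Definition int_index (i : int) : nat :=
  match i with Posz n => n.*2 | Negz n => n.*2.+1 end.

Definition index_int (j : nat) : int :=
  if odd j then Negz j./2 else Posz j./2.

Lemma index_intK : cancel index_int int_index.
Proof.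
move=> j; rewrite /index_int -[in RHS](odd_double_half j).
by case: (odd j).
Qed.

Lemma int_indexK : cancel int_index index_int.
Proof.
case=> n; rewrite /index_int /= ?odd_double ?doubleK //.
by rewrite /= uphalf_double.
Qed.

Lemma int_index_window (n : nat) (t : int) :
  (`|t| <= n)%N -> (int_index t < n.+1.*2)%N.
Proof. by case: t => k; rewrite /int_index ?absz_nat ?NegzE ?abszN; lia. Qed.

Lemma measure_partition (d : measure_display) (T : measurableType d)
    (R : realType) (mu : {measure set T -> \bar R}) (I : finType) (f : T -> I)
    (E : set T) : (forall i, measurable (E `&` [set t | f t = i])) ->
  measurable E /\ mu E = (\sum_i mu (E `&` [set t | f t = i]))%E.
Proof.
move=> mE; have key (s : seq I) : uniq s ->
    measurable (E `&` [set t | f t \in s]) /\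
    mu (E `&` [set t | f t \in s]) = (\sum_(i <- s) mu (E `&` [set t | f t = i]))%E.
  elim: s => [_|i s IH /= /andP[nis us]].
    rewrite big_nil (_ : _ `&` _ = set0) ?measure0 //.
    by rewrite -subset0 => k [].
  have [m1 e1] := IH us.
  have -> : E `&` [set t | f t \in i :: s] =
      (E `&` [set t | f t = i]) `|` (E `&` [set t | f t \in s]).
    apply/seteqP; split => k /=.
      by rewrite inE => -[Ek /orP[/eqP|]]; [left|right].
    by rewrite inE => -[[Ek ->]|[Ek ->]]; rewrite ?eqxx ?orbT.
  split; first exact: measurableU.
  rewrite big_cons -e1 measureU // -subset0 => k /= [[_ fi] [_]].
  by rewrite fi (negbTE nis).
have := key _ (index_enum_uniq _); rewrite (_ : E `&` _ = E) //.
by apply/seteqP; split => [k []//|k Ek]; split => //=; rewrite mem_index_enum.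
Qed.

Definition word_of (x : full_shift) (n : nat) : seq bool :=
  mkseq (fun j => x (index_int j)) n.

Definition of_word (w : seq bool) : full_shift :=
  fun i => nth false w (int_index i).

Lemma agree_of_word (n : nat) (x : full_shift) :
  agree n x (of_word (word_of x n.+1.*2)).
Proof.
move=> t tn; rewrite /of_word nth_mkseq ?int_indexK //.
exact: int_index_window.
Qed.

Lemma mnormalize_mass1 (d : measure_display) (T : measurableType d)
    (R : realType) (mu : {measure set T -> \bar R}) (P : probability T R) :
  mu setT = 1%E -> mnormalize mu P = mu.
Proof.
by move=> mu1; apply/funext => E; rewrite /mnormalize mu1 onee_eq0 /= invr1 mule1.
Qed.

Lemma unit_interval_probability (R : realType) :
  exists P : probability (measurableTypeR R) R,
    forall E, P E = lebesgue_measure (E `&` `[0, 1[%classic).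
Proof.
have m01 : measurable (`[0, 1[%classic : set (measurableTypeR R)) by [].
pose mu : {measure set (measurableTypeR R) -> \bar R} :=
  mrestr (@lebesgue_measure R) m01.
have muE E : mu E = lebesgue_measure (E `&` `[0, 1[%classic) by exact: erefl.
have mu1 : mu setT = 1%E.
  rewrite muE setTI; have := @lebesgue_measure_itv R `[0, 1[.
  by rewrite /= lte_fin ltr01 oppr0 adde0.
exists (mnormalize mu (@dirac _ (measurableTypeR R) (0 : R) R)) => E.
by rewrite -muE; exact: (congr1 (fun g => g E) (mnormalize_mass1 _ mu1)).
Qed.

(** The weights that a mean gives to the words read along the orbit of [y] are
    consistent, and coin tossing realizes them. *)
Lemma mean_measure (R : realType) (m : set int -> R) (y : full_shift) :
  invariant_mean m ->
  exists mu : probability borel_full_shift R, forall n C, window_set n C ->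
    mu C = (m [set k | C (shift_pow k y)])%:E.
Proof.
move=> im.
pose q w := m [set k | word_of (shift_pow k y) (size w) = w].
have qnil : q [::] = 1.
  by rewrite /q (_ : [set _ | _] = setT) //; [case: im|apply/seteqP; split].
have q0 w : 0 <= q w by case: im => + _ _ _; exact.
have qD w : q w = q (rcons w false) + q (rcons w true).
  have [_ _ mU _] := im; rewrite /q -mU !size_rcons.
    congr (m _); apply/seteqP; split => k /=; rewrite /word_of mkseqS.
      move=> ->; case: (shift_pow k y (index_int (size w))); by [right|left].
    by move=> [|] /rcons_inj[].
  rewrite -subset0 => k /=; rewrite /word_of mkseqS => -[/rcons_inj[_ ->]].
  by move=> /rcons_inj[].
have [f hf] := coin_tossing qnil q0 qD.
have [P hP] := unit_interval_probability R.
pose psi (t : measurableTypeR R) : borel_full_shift := fun i => f t (int_index i).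
have word_psi t n : word_of (psi t) n = mkseq (f t) n.
  by apply: eq_map => j; rewrite /psi index_intK.
pose tup (x : full_shift) n : n.-tuple bool :=
  Tuple (introT eqP (size_mkseq (fun j => x (index_int j)) n)).
have tupE x n (w : n.-tuple bool) : tup x n = w <-> word_of x n = w.
  by split => [<- //|e]; apply/val_inj.
have CE n C x : window_set n C -> C x <-> C (of_word (word_of x n.+1.*2)).
  move=> wC; split; apply: wC; first exact: agree_of_word.
  exact/agreeC/agree_of_word.
have piece n C (w : (n.+1.*2).-tuple bool) : window_set n C ->
    (psi @^-1` C) `&` [set t | tup (psi t) n.+1.*2 = w] =
    if `[< C (of_word w) >] then [set t | mkseq (f t) (size w) = w] else set0.
  move=> wC; rewrite size_tuple; case: asboolP => Cw; apply/seteqP; split => t //=.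
  - by move=> [_ /tupE]; rewrite word_psi.
  - move=> e; have e' : word_of (psi t) n.+1.*2 = w by rewrite word_psi.
    by split; [apply/(CE n) => //; rewrite e'|apply/tupE].
  - by move=> [/(CE n _ _ wC) + /tupE e]; rewrite e => /Cw.
have mpiece n C w : window_set n C -> measurable ((psi @^-1` C) `&`
    [set t | tup (psi t) n.+1.*2 = w] : set (measurableTypeR R)).
  by move=> wC; rewrite piece //; case: ifP => // _; exact: (hf w).1.
have mpsi : measurable_fun setT psi.
  have gen : @measurable _ borel_full_shift = <<s window_sets >>.
    exact: borel_window_sets.
  apply: (@measurability _ _ _ borel_full_shift setT psi window_sets gen) => _ [C [n wC] <-].
  by rewrite setTI; apply: (measure_partition P (f := fun t => tup (psi t) n.+1.*2) _).1 => w;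
    exact: mpiece.
pose X : {mfun measurableTypeR R >-> borel_full_shift} :=
  HB.pack psi (isMeasurableFun.Build _ _ _ _ psi mpsi).
exists (distribution P X) => n C wC; transitivity (P (psi @^-1` C)); first exact: erefl.
have [_ ->] := @measure_partition _ _ R P _ (fun t => tup (psi t) n.+1.*2)
  (psi @^-1` C) (fun w => mpiece n C w wC).
rewrite (mean_partition (fun k => tup (shift_pow k y) n.+1.*2) _ im) -sumEFin.
apply: eq_bigr => w _; rewrite piece //.
case: asboolP => Cw.
  apply: (etrans (hP _)); rewrite setIC (hf w).2 /q size_tuple; congr (m _)%:E.
  apply/seteqP; split => k /=; last by move=> [_ /tupE].
  by move=> e; split; [apply/(CE n) => //; rewrite e|apply/tupE].
rewrite measure0 (_ : _ `&` _ = set0) ?mean_set0 // -subset0 => k /=.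
by move=> [/(CE n _ _ wC) + /tupE e]; rewrite e => /Cw.
Qed.

Lemma shift_powD (j k : int) (y : full_shift) :
  shift_pow j (shift_pow k y) = shift_pow (j + k) y.
Proof. by apply/funext => n; rewrite /shift_pow addrA. Qed.

Lemma shift_pow_measurable k :
  measurable_fun setT (shift_pow k : borel_full_shift -> borel_full_shift).
Proof.
have gen : @measurable _ borel_full_shift = <<s window_sets >>.
  exact: borel_window_sets.
apply: (@measurability _ _ borel_full_shift borel_full_shift setT (shift_pow k)
  window_sets gen) => _ [C [n wC] <-].
by rewrite setTI; apply: measurable_window_set (window_set_shift wC).
Qed.

Lemma shift_invariant_window (R : realType) (mu : probability borel_full_shift R) :
  (forall n C, window_set n C -> mu (left_shift @^-1` C) = mu C) ->
  shift_invariant mu.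
Proof.
move=> h A mA.
pose X : {mfun borel_full_shift >-> borel_full_shift} :=
  HB.pack (left_shift : borel_full_shift -> borel_full_shift)
    (isMeasurableFun.Build _ _ borel_full_shift borel_full_shift
       left_shift (shift_pow_measurable 1)).
exact: (@probability_window_uniq R (distribution mu X) mu _ A mA).
Qed.

Lemma orbit_closure_compl (y : full_shift) :
  ~` orbit_closure y =
  \bigcup_n [set z | forall k, ~ agree n z (shift_pow k y)].
Proof.
apply/seteqP; split => z.
  move=> nz; apply: contrapT => h; apply: nz; apply/orbit_closureP => n.
  apply: contrapT => /forallNP hn; apply: h; by exists n.
move=> [n _ hn] /orbit_closureP /(_ n)[k]; exact: hn.
Qed.

Lemma window_set_off_orbit (y : full_shift) n :
  window_set n [set z | forall k, ~ agree n z (shift_pow k y)].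
Proof. by move=> z z' zz' h k z'k; apply: (h k); exact: agree_trans z'k. Qed.

Lemma measurable_orbit_closure (y : full_shift) :
  measurable (orbit_closure y : set borel_full_shift).
Proof.
rewrite -[orbit_closure y]setCK; apply: measurableC.
rewrite orbit_closure_compl; apply: bigcup_measurable => n _.
exact: measurable_window_set (@window_set_off_orbit y n).
Qed.

Lemma mean_invariant_measure (R : realType) (m : set int -> R) (y : full_shift) :
  invariant_mean m ->
  exists mu : probability borel_full_shift R,
    [/\ shift_invariant mu, mu (orbit_closure y) = 1%E &
      forall n C, window_set n C -> mu C = (m [set k | C (shift_pow k y)])%:E].
Proof.
move=> im; have [mu hmu] := mean_measure y im; exists mu; split => //.
- apply: shift_invariant_window => n C wC.
  rewrite (hmu _ _ (window_set_shift (k := 1) wC)) (hmu _ _ wC).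
  rewrite -(mean_translate 1 [set k | C (shift_pow k y)] im).
  congr (m _)%:E; apply/seteqP; rewrite /translate.
  by split => k; rewrite /left_shift /= shift_powD addrC.
- have mX := measurable_orbit_closure y.
  have mu0 : mu (~` orbit_closure y) = 0%E.
    apply/negligibleP; first exact: measurableC.
    rewrite orbit_closure_compl; apply: negligible_bigcup => n.
    have wn := @window_set_off_orbit y n.
    apply/negligibleP; first exact: measurable_window_set wn.
    apply: (etrans (hmu _ _ wn)); rewrite (_ : [set k | _] = set0) ?mean_set0 //.
    by rewrite -subset0 => k /= /(_ k); apply.
  have := probability_setC mu (measurableC mX); rewrite setCK mu0 => ->.
  by rewrite sube0.
Qed.

(** * Unique ergodicity and frequencies of visits *)

(** The measure defined by a mean gives the sequences with a one at the origin the
    mean of the free integers. *)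
Lemma uniquely_ergodic_mean (R : realType) (A : set nat) :
  uniquely_ergodic R (orbit_closure (eta A)) ->
  exists c, forall m : set int -> R, invariant_mean m -> m (free_integers A) = c.
Proof.
move=> [mu [_ _ uniq]].
pose C : set full_shift := [set x | x 0].
have wC : window_set 0 C by move=> x y xy Cx; rewrite /C /= -xy.
exists (fine (mu C)) => m im.
have [nu [inu nuX hnu]] := mean_invariant_measure (eta A) im.
rewrite -(uniq nu inu nuX) ?(hnu _ _ wC) /=; last exact: measurable_window_set wC.
congr (m _); apply/seteqP; split => k; rewrite /C /shift_pow /eta /= add0r.
  by move/mem_set.
by move/set_mem.
Qed.

Lemma density_of_means (R : realType) (E : set int) (c : R) :
  (forall m : set int -> R, invariant_mean m -> m E = c) ->
  has_density R E /\ density R E = c.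
Proof.
move=> hE; have cvgc : frequency R E @ \oo --> c.
  apply/cvgrPdist_le => e e0; have [L0 h] := uniform_window hE e0.
  by exists L0 => // L /= L0L; rewrite frequency_window distrC; exact: h.
by split; [apply/cvg_ex; exists c|apply: cvg_lim].
Qed.

Lemma shift_powS_invariant (R : realType) (nu : probability borel_full_shift R)
    (C : set borel_full_shift) (i : nat) : shift_invariant nu -> measurable C ->
  nu (shift_pow i%:Z @^-1` C) = nu C.
Proof.
move=> inu mC; elim: i => [|i IH].
  by congr (nu _); apply/seteqP; split => x /=; rewrite (_ : shift_pow 0 x = x) //;
    apply/funext => n; rewrite /shift_pow addr0.
rewrite -IH -[RHS]inu; last first.
  by rewrite -[X in measurable X]setTI; apply: shift_pow_measurable.
congr (nu _); apply/seteqP.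
by split => x /=; rewrite /left_shift shift_powD intS addrC.
Qed.

(** The measure of [C] is the integral of the average number of visits to [C]
    during [L] steps, which uniformity controls at every point of the orbit
    closure, since a finite stretch of its orbit is seen along that of [y]. *)
Lemma uniform_visits_le (R : realType) (y : full_shift) (n : nat)
    (C : set full_shift) (c e : R) (nu : probability borel_full_shift R) :
  0 <= c -> 0 < e -> window_set n C ->
  (forall m : set int -> R, invariant_mean m -> m [set k | C (shift_pow k y)] = c) ->
  shift_invariant nu -> nu (orbit_closure y) = 1%E ->
  (nu C <= (c + e)%:E)%E.
Proof.
move=> c0 e0 wC hc inu nuX.
have [L0 hL] := uniform_window hc e0; pose L := L0.+1.
have LR : 0 < L%:R :> R by rewrite ltr0n.
pose X : set borel_full_shift := orbit_closure y.
have mX : measurable X := measurable_orbit_closure y.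
pose A (i : 'I_L) : set borel_full_shift := shift_pow i.+1%:Z @^-1` C.
have mC : measurable (C : set borel_full_shift) by exact: measurable_window_set wC.
have mA i : measurable (A i).
  by rewrite -[A i]setTI; apply: shift_pow_measurable.
have nuX0 : nu (~` X) = 0%E by rewrite probability_setC // nuX subee.
have nuAX i : nu (A i `&` X) = nu C.
  rewrite -(shift_powS_invariant i.+1 inu mC) -/(A i).
  have out : nu (A i `\` X) = 0%E.
    apply/eqP; rewrite eq_le measure_ge0 andbT -nuX0; apply: le_measure;
      rewrite ?inE; [exact: measurableD|exact: measurableC|by move=> x []].
  apply/esym; apply: (etrans (measureDI nu (mA i) mX)).
  by apply: (etrans (congr1 (fun z => z + _)%E out)); exact: add0e.
have nuC : nu C \is a fin_num by exact: fin_num_measure.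
have le_int : (\int[nu]_(x in X) (\sum_(i < L) (\1_(A i) x)%:E) <=
    \int[nu]_(x in X) ((c + e) * L%:R)%:E)%E.
  apply: ge0_le_integral => //.
  - by move=> x _; apply: sume_ge0 => i _; rewrite lee_fin.
  - apply: emeasurable_sum => i; apply/measurable_EFinP.
    by apply: measurable_funTS; exact: measurable_indic.
  - move=> x /orbit_closureP /(_ (n + L)%N) [k xk].
    rewrite sumEFin lee_fin -ler_pdivrMr //.
    have := hL L k (leqnSn _); rewrite ler_norml => /andP[_].
    rewrite lerBlDl addrC => /(le_trans _); apply.
    apply: ler_wpM2r; first by rewrite invr_ge0 ler0n.
    apply: ler_sum => i _.
    rewrite indicE ler_nat; case: (boolP (x \in A i)) => // /set_mem Ax.
    suff -> : k + i.+1%:Z \in [set k | C (shift_pow k y)] by [].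
    apply/mem_set; rewrite /= addrC -shift_powD; apply: wC Ax => t tn.
    rewrite /shift_pow; apply: xk; have := ltn_ord i; clear -tn; lia.
move: le_int; rewrite ge0_integral_sum //; last first.
  by move=> i; apply/measurable_EFinP/measurable_funTS; exact: measurable_indic.
rewrite (eq_bigr (fun=> (fine (nu C))%:E)); last first.
  move=> i _; rewrite fineK //.
  exact: (etrans (integral_indic nu mX (mA i)) (nuAX i)).
rewrite integral_cst // [X in (_ <= _ * X)%E](_ : _ = 1%E); last exact: nuX.
rewrite mule1 sumEFin sumr_const card_ord lee_fin -[X in X <= _]mulr_natr.
by rewrite ler_pM2r // => h; rewrite -(fineK nuC) lee_fin.
Qed.

(** Applied to a window set and to its complement, [uniform_visits_le] determines
    its measure. *)
Lemma uniquely_ergodic_of_means (R : realType) (y : full_shift) :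
  (forall n C, window_set n C -> exists c, forall m : set int -> R,
     invariant_mean m -> m [set k | C (shift_pow k y)] = c) ->
  uniquely_ergodic R (orbit_closure y).
Proof.
move=> H.
have [m [im _]] := @window_mean R (fun=> 0) S (fun n => leqnn _).
have [mu [inu muX hmu]] := mean_invariant_measure y im.
exists mu; split => // nu inu' nuX; apply: probability_window_uniq => n C wC.
have [c hc] := H n C wC.
have c01 : 0 <= c <= 1.
  have [m0 m1 _ _] := im; rewrite -(hc m im) m0 /= -m1.
  exact: mean_le.
have mC := measurable_window_set wC.
have nuC : nu C \is a fin_num by exact: fin_num_measure.
have /andP[c0 c1] := c01.
have upper e : 0 < e -> (nu C <= (c + e)%:E)%E.
  by move=> e0; exact: (uniform_visits_le c0 e0 wC hc inu' nuX).
have lower e : 0 < e -> (nu (~` C) <= (1 - c + e)%:E)%E.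
  move=> e0; have c1' : 0 <= 1 - c by rewrite subr_ge0.
  apply: (uniform_visits_le c1' e0 (window_setC wC) _ inu' nuX) => m' im'.
  by rewrite -(hc m' im') -mean_setC.
rewrite (hmu n C wC) hc // -(fineK nuC); congr (_%:E); apply/eqP; rewrite eq_le.
apply/andP; split; apply/ler_addgt0Pr => e e0.
  by rewrite -lee_fin fineK // upper.
have := lower e e0; rewrite probability_setC // -(fineK nuC) -EFinB lee_fin /=.
by lra.
Qed.

(** * Regular Toeplitz sequences *)

(** Where all the coordinates of a window are periodic with periods at most [r],
    the visits to [C] are periodic; the other positions have small mean. *)
Lemma regular_toeplitz_means (R : realType) (x : full_shift) n C :
  regular_toeplitz R x -> window_set n C ->
  exists c, forall m : set int -> R, invariant_mean m ->
    m [set k | C (shift_pow k x)] = c.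
Proof.
move=> [_ reg] wC; set E := [set k | C (shift_pow k x)].
have [m0 [im0 _]] := @window_mean R (fun=> 0) S (fun n => leqnn _).
pose P r := \bigcup_(s in [set s | (0 < s <= r)%N]) Per x s.
have pP r : periodic r`! (P r).
  apply: periodic_exists => s /= s0r.
  apply: (@periodic_dvdn s); first exact: dvdn_fact.
  move=> k j /dvdzP[q kj] Pk l.
  have -> : j = k + s%:Z * q by rewrite mulrC -kj; ring.
  by rewrite -addrA -mulrDr !Pk.
have dP r (m : set int -> R) : invariant_mean m -> m (P r) = density R (P r).
  move=> im; have [|_ ->] := @density_of_means R (P r) (m (P r)) _ => // m' im'.
  exact: mean_periodic_uniq im' im (fact_gt0 r) (pP r).
pose T := [seq i%:Z - n%:Z | i <- iota 0 n.*2.+1].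
have TP (t : int) : (`|t| <= n)%N -> t \in T.
  move=> tn; apply/mapP; exists `|(t + n%:Z)%R|%N; last by clear -tn; lia.
  by rewrite mem_iota; clear -tn; lia.
pose bad r := [set k | exists2 t, t \in T & translate t (~` P r) k].
have pgood r : periodic r`! (~` bad r).
  apply: periodicC; rewrite (_ : bad r = \bigcup_(t in [set` T]) translate t (~` P r)).
    by apply: periodic_exists => t _; apply: periodic_translate; exact: periodicC.
  by apply/seteqP; split => k [t tT ?]; exists t.
have pEgood r : periodic r`! (E `&` ~` bad r).
  move=> k j kj [Ek gk]; split; last exact: (pgood r k).
  apply: wC Ek => t tn; rewrite /shift_pow.
  have [s s0r Ps] : P r (k + t).
    by apply: contrapT => nP; apply: gk; exists t => //; exact: TP.
  have /dvdzP[q jkq] : (s%:Z %| j - k)%Z by apply: dvdz_trans kj; exact: dvdn_fact.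
  have -> : t + j = k + t + s%:Z * q by rewrite mulrC -jkq; ring.
  by rewrite Ps addrC.
have bad_le r (m : set int -> R) : invariant_mean m ->
    m (bad r) <= n.*2.+1%:R * (1 - density R (P r)).
  move=> im; apply: (le_trans (mean_bigU_le _ _ im)).
  rewrite (eq_bigr (fun=> 1 - density R (P r))); last first.
    by move=> t _; rewrite mean_translate // mean_setC // dP.
  rewrite big_const_seq count_predT size_map size_iota iter_addr_0.
  by rewrite mulr_natl.
have one_side (m m' : set int -> R) : invariant_mean m -> invariant_mean m' ->
    m E <= m' E.
  move=> im im'; apply/ler_addgt0Pr => e e0.
  have e1 : 0 < e / n.*2.+1%:R by rewrite divr_gt0 ?ltr0n.
  have /cvgrPdist_le /(_ _ e1) [r _ /(_ r (leqnn r)) /= hr] := reg.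
  have {}hr : n.*2.+1%:R * (1 - density R (P r)) <= e.
    rewrite mulrC -ler_pdivlMr ?ltr0n //; apply: le_trans hr; exact: ler_norm.
  have h1 : m (E `&` ~` bad r) <= m' E.
    rewrite (mean_periodic_uniq im im' (fact_gt0 r) (pEgood r)).
    by apply: mean_le => // k [].
  have h2 : m (E `\` (~` bad r)) <= m (bad r).
    by apply: mean_le => // k [_ /contrapT].
  have := meanD E (~` bad r) im; have := bad_le r m im.
  by lra.
by exists (m0 E) => m im; apply/eqP; rewrite eq_le !one_side.
Qed.

Lemma regular_toeplitz_uniquely_ergodic (R : realType) (x : full_shift) :
  regular_toeplitz R x -> uniquely_ergodic R (orbit_closure x).
Proof.
move=> reg; apply: uniquely_ergodic_of_means => n C wC.
exact: regular_toeplitz_means wC.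
Qed.

(** * The upper bound for the entropy *)

(** Markov's inequality for the weight [z ^ #|E|] with [z = exp (- J)]. *)
Lemma card_small_sets (R : realType) (L : nat) (a J : R) : 0 <= J ->
  #|[set E : {set 'I_L} | #|E|%:R <= a]%SET|%:R <=
    expR (J * a + expR (- J) * L%:R).
Proof.
move=> J0; set small := [set _ | _]%SET.
have sumz : \sum_(E : {set 'I_L}) expR (- J) ^+ #|E| = (1 + expR (- J)) ^+ L.
  transitivity (\prod_(i < L) (expR (- J) + 1)); last first.
    by rewrite prodr_const card_ord addrC.
  rewrite bigA_distr; apply: eq_bigr => E _.
  by rewrite -big_mkcond prodr_const.
have : #|small|%:R * expR (- J * a) <= (1 + expR (- J)) ^+ L.
  rewrite -sumz -sum1_card natr_sum mulr_suml big_mkcond /=; apply: ler_sum => E _.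
  case: ifP => [|_]; last by rewrite exprn_ge0 // expR_ge0.
  rewrite inE mul1r => Ea; rewrite -expRM_natl ler_expR mulrC ler_wnM2r //.
  by rewrite oppr_le0.
rewrite mulNr (expRN (J * a)) ler_pdivrMr ?expR_gt0 // => /le_trans; apply.
rewrite expRD mulrC ler_wpM2l ?expR_ge0 // mulrC expRM_natl.
by rewrite lerXn2r ?nnegrE ?addr_ge0 ?expR_ge0 // expR_ge1Dx.
Qed.

(** The window of [window_average R k] starts at [k + 1]. *)
Lemma card_window (R : realType) (L : nat) (k : int) (E : set int) : (0 < L)%N ->
  #|[set i : 'I_L | k + i%:Z \in E]%SET|%:R = window_average R (k - 1) L E * L%:R.
Proof.
move=> L0; rewrite /window_average divfK ?pnatr_eq0 -?lt0n //.
rewrite -sum1_card natr_sum big_mkcond; apply: eq_bigr => i _.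
have -> : k - 1 + i.+1%:Z = k + i%:Z by rewrite intS; ring.
by rewrite inE; case: ifP.
Qed.

Lemma appears_eta (B : set nat) (L : nat) (w : {ffun 'I_L -> bool}) :
  appears w (orbit_closure (eta B)) ->
  exists k : int, forall i : 'I_L, w i = (k + i%:Z \in free_integers B).
Proof.
move=> [x /orbit_closureP hx [j hw]].
have [k hk] := hx (`|j| + L)%N.
exists (j + k) => i; rewrite hw hk; first by rewrite /shift_pow /eta addrAC.
by have := ltn_ord i; clear; lia.
Qed.

(** A block of [eta B] is determined by the residue of its position, its ones
    outside [V] and its zeros inside [V]; the latter are among the few positions of
    [V] outside [F]. *)
Lemma complexity_upper (R : realType) (B : set nat) (F : set int) (U V : set int)
    (Q L : nat) (s a J : R) :
  periodic Q.+1 U -> periodic Q.+1 V -> F `<=` free_integers B ->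
  free_integers B `<=` U -> 0 <= J ->
  (forall k : int, #|[set i : 'I_L | k + i%:Z \in U `\` V]%SET|%:R <= s) ->
  (forall k : int, #|[set i : 'I_L | k + i%:Z \in V `\` F]%SET|%:R <= a) ->
  ln (complexity (orbit_closure (eta B)) L)%:R <=
    ln Q.+1%:R + s * ln 2 + (J * a + expR (- J) * L%:R) :> R.
Proof.
move=> pU pV FB BU J0 hs ha.
pose D (r : 'I_Q.+1) := [set i : 'I_L | r%:Z + i%:Z \in U `\` V]%SET.
pose small := [set E : {set 'I_L} | #|E|%:R <= a]%SET.
pose dec (r : 'I_Q.+1) (SE : {set 'I_L} * {set 'I_L}) : {ffun 'I_L -> bool} :=
  [ffun i => (i \in SE.1) || (r%:Z + i%:Z \in V) && (i \notin SE.2)].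
pose code r := [set dec r SE | SE in finset.setX (powerset (D r)) small]%SET.
have sub : [set w : {ffun 'I_L -> bool} | `[< appears w (orbit_closure (eta B)) >]]%SET
    \subset (\bigcup_r code r)%SET.
  apply/fintype.subsetP => w; rewrite inE => /asboolP/appears_eta[k hk].
  pose r := residue Q k.
  have kr (P : set int) i : periodic Q.+1 P -> (r%:Z + i \in P) = (k + i \in P).
    move=> pP; have rk : (Q.+1%:Z %| k - r%:Z)%Z by apply/residue_class.
    apply/idP/idP => /set_mem h; apply/mem_set; apply: (pP _ _ _ h).
      by rewrite opprD addrACA subrr addr0.
    by rewrite opprD addrACA subrr addr0 -rpredN opprB.
  have pUV : periodic Q.+1 (U `\` V).
    by rewrite setDE; apply: periodicI => //; exact: periodicC.
  apply/finset.bigcupP; exists r => //; apply/imsetP.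
  exists ([set i in D r | w i]%SET, [set i : 'I_L | (r%:Z + i%:Z \in V) && ~~ w i]%SET).
    rewrite inE; apply/andP; split; rewrite inE /=.
      by apply/fintype.subsetP => i; rewrite inE => /andP[].
    apply: le_trans (ha k); rewrite ler_nat; apply: subset_leq_card.
    apply/fintype.subsetP => i; rewrite !inE kr // => /andP[/set_mem Vi nw].
    split => // Fi; move: nw; rewrite hk.
    by move/negP; apply; apply/mem_set/FB.
  apply/ffunP => i; rewrite ffunE !inE /= kr // kr //.
  have [Vi|nVi] := boolP (k + i%:Z \in V).
    rewrite /= negbK; case: (w i); rewrite ?andbF ?orbT ?orbF //.
  rewrite /= orbF; have [wi|] := boolP (w i); last by rewrite andbF.
  rewrite andbT; apply/esym/mem_set; split; last by move/mem_set; apply/negP.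
  by apply: BU; apply/set_mem; rewrite -hk.
have card_code r : #|code r|%:R <= expR (s * ln 2 + (J * a + expR (- J) * L%:R)).
  apply: (@le_trans _ _ (2 ^ #|D r| * #|small|)%:R).
    by rewrite ler_nat -card_powerset -cardsX leq_imset_card.
  rewrite natrM expRD ler_pM // ?card_small_sets //.
  rewrite natrX -[2 in X in X <= _](@lnK R) ?posrE // -expRM_natl ler_expR.
  by rewrite ler_wpM2r ?(ltW (ln2_gt0 R)) //; exact: hs.
rewrite -addrA -ler_expR lnK ?posrE ?ltr0n; last first.
  exact/complexity_gt0/orbit_closure_nonempty.
rewrite expRD lnK ?posrE ?ltr0n //.
apply: (@le_trans _ _ (\sum_(r < Q.+1) #|code r|%:R)).
  rewrite -natr_sum ler_nat; apply: (@leq_trans #|(\bigcup_r code r)%SET|).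
    by apply: leq_trans (subset_leq_card sub); rewrite cardsE.
  apply: (big_ind2 (fun (A : {set {ffun 'I_L -> bool}}) n => #|A| <= n)%N) => //.
    by rewrite cards0.
  move=> A1 n1 A2 n2 h1 h2; apply: leq_trans (leq_add h1 h2).
  by rewrite cardsU leq_subr.
apply: (le_trans (ler_sum _ (fun r _ => card_code r))).
by rewrite sumr_const card_ord mulr_natl.
Qed.

Lemma mean_window_card (R : realType) (E : set int) (c e : R) :
  (forall m : set int -> R, invariant_mean m -> m E = c) -> 0 < e ->
  exists L0, forall L (k : int), (L0 <= L)%N ->
    `|#|[set i : 'I_L | k + i%:Z \in E]%SET|%:R - c * L%:R| <= e * L%:R.
Proof.
move=> hE e0; have [L0 h] := uniform_window hE e0.
exists (maxn 1 L0) => L k; rewrite geq_max => /andP[L1 LL].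
rewrite card_window // -mulrBl normrM (ger0_norm (ler0n _ _)).
by rewrite ler_wpM2r // h.
Qed.

Lemma card_window_diff (R : realType) (L : nat) (k : int) (U V : set int) :
  V `<=` U ->
  #|[set i : 'I_L | k + i%:Z \in U `\` V]%SET|%:R =
  #|[set i : 'I_L | k + i%:Z \in U]%SET|%:R -
  #|[set i : 'I_L | k + i%:Z \in V]%SET|%:R :> R.
Proof.
move=> VU; set SU := [set i : 'I_L | k + i%:Z \in U]%SET.
set SV := [set i : 'I_L | k + i%:Z \in V]%SET.
have SVU : SV \subset SU.
  by apply/fintype.subsetP => i; rewrite !inE; exact: VU.
have -> : [set i : 'I_L | k + i%:Z \in U `\` V]%SET = (SU :\: SV)%SET.
  apply/setP => i; rewrite !inE; apply/idP/andP => [/set_mem[Ui nVi]|[nVi Ui]].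
    by split; [apply/negP => /set_mem|apply/mem_set].
  apply/mem_set; split; first exact/set_mem.
  by move/mem_set; apply/negP.
by rewrite cardsD (finset.setIidPr SVU) natrB // subset_leq_card.
Qed.

(** Take for [U] and [V] the free integers of finite stages of [B] and of its union
    with the coprime dilations, with means close to the upper density and to [d]:
    by uniformity, these are the frequencies in all long windows, and those of the
    free integers of [star B] are close to [d] too. *)
Lemma entropy_upper (R : realType) (B : set nat) (d : R) :
  (forall b, B b -> (0 < b)%N) ->
  (forall m : set int -> R, invariant_mean m -> m (free_integers (star B)) = d) ->
  entropy R (orbit_closure (eta B)) <= upper_density R (free_integers B) - d.
Proof.
move=> B0 hd; set u := upper_density R _.
have C0 := star_union_gt0 B0; have FstarE := free_star B0.
set C := B `|` coprime_dilations B in C0 FstarE.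
have [m [im sm mF]] := davenport_erdos R.
apply/ler_addgt0Pr => e e0.
have l2 := ln2_gt0 R.
(* the residues and [expR (- J)] cost at most [z] each, while the windows and the
   exceptional positions cost [3 * dl * ln 2] and [3 * J * dl] *)
pose z : R := Num.min 1 (e * ln 2 / 8).
have z0 : 0 < z by rewrite lt_min ltr01 divr_gt0 ?mulr_gt0.
have z1 : z <= 1 by rewrite ge_min lexx.
have ze : z * 8 <= e * ln 2 by rewrite -ler_pdivlMr // ge_min lexx orbT.
pose J : R := - ln z.
have J0 : 0 <= J by rewrite oppr_ge0 ln_le0.
have expJ : expR (- J) = z by rewrite opprK lnK.
pose dl : R := z / (1 + J).
have J1 : 0 < 1 + J by lra.
have dl0 : 0 < dl by rewrite divr_gt0.
have dlz : dl + J * dl = z by rewrite /dl; field; rewrite gt_eqF.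
have Jdl0 : 0 <= J * dl by rewrite mulr_ge0 // ltW.
have [K1 hK1] := sm B B0 dl dl0.
have [K2 hK2] := sm C C0 dl dl0.
pose K := maxn K1 K2.
pose U := free_integers (upto K B); pose V := free_integers (upto K C).
have mono (A : set nat) K0 : (K0 <= K)%N ->
    free_integers (upto K A) `<=` free_integers (upto K0 A).
  move=> K0K; apply: subsetC; apply: multiplesS => a [Aa aK].
  by split => //; exact: leq_trans K0K.
have mU : m U <= u + dl.
  rewrite /u -mF //; apply: le_trans hK1; apply: mean_le => //.
  by apply: mono; exact: leq_maxl.
have mV : m V <= d + dl.
  rewrite -(hd m im) FstarE; apply: le_trans hK2; apply: mean_le => //.
  by apply: mono; exact: leq_maxr.
have [Q QE] : exists Q, K`! = Q.+1 by exists K`!.-1; rewrite prednK // fact_gt0.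
have pU : periodic Q.+1 U by rewrite -QE; exact: periodic_free_upto.
have pV : periodic Q.+1 V by rewrite -QE; exact: periodic_free_upto.
pose F := free_integers (star B).
have FV : F `<=` V by rewrite /F FstarE; apply: subsetC; apply: multiplesS => a [].
have FB : F `<=` free_integers B.
  by rewrite /F FstarE; apply: subsetC; apply: multiplesS => a Ba; left.
have BU : free_integers B `<=` U by apply: subsetC; apply: multiplesS => a [].
have VU : V `<=` U.
  by apply: subsetC; apply: multiplesS => a [Ba aK]; split => //; left.
have [LU hLU] := @mean_window_card R U (m U) dl
  (fun m' im' => mean_periodic_uniq im' im (ltn0Sn Q) pU) dl0.
have [LV hLV] := @mean_window_card R V (m V) dl
  (fun m' im' => mean_periodic_uniq im' im (ltn0Sn Q) pV) dl0.
have [LF hLF] := @mean_window_card R F d dl hd dl0.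
apply: limr_le; first exact/entropy_cvg/orbit_closure_nonempty.
near=> L.
have L0 : (0 < L)%N by near: L; exists 1%N.
have LLU : (LU <= L)%N by near: L; exists LU.
have LLV : (LV <= L)%N by near: L; exists LV.
have LLF : (LF <= L)%N by near: L; exists LF.
have LR : 0 < L%:R :> R by rewrite ltr0n.
have lnQ : ln Q.+1%:R <= z * L%:R.
  by rewrite mulrC -ler_pdivrMr //; near: L; exact: nbhs_infty_ger.
rewrite ler_pdivrMr // ler_pdivrMr //.
have FVk (k : int) : #|[set i : 'I_L | k + i%:Z \in F]%SET|%:R <=
    #|[set i : 'I_L | k + i%:Z \in V]%SET|%:R :> R.
  by rewrite -subr_ge0 -card_window_diff // ler0n.
have hs (k : int) : #|[set i : 'I_L | k + i%:Z \in U `\` V]%SET|%:R <=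
    (u - d + 3 * dl) * L%:R.
  rewrite card_window_diff //; have := FVk k.
  have := hLU L k LLU; have := hLF L k LLF; rewrite !ler_norml.
  have := ler_wpM2r (ltW LR) mU; move=> h1 /andP[h2 _] /andP[_ h3] h4.
  rewrite mulrDl in h1; rewrite !mulrDl mulNr; lra.
have ha (k : int) : #|[set i : 'I_L | k + i%:Z \in V `\` F]%SET|%:R <=
    3 * dl * L%:R.
  rewrite card_window_diff //.
  have := hLV L k LLV; have := hLF L k LLF; rewrite !ler_norml.
  have := ler_wpM2r (ltW LR) mV; move=> h1 /andP[h2 _] /andP[_ h3].
  rewrite mulrDl in h1; lra.
apply: (le_trans (complexity_upper pU pV FB BU J0 hs ha)).
rewrite expJ.
have ln2_le1 : ln 2 <= 1 :> R.
  by have := @le_ln1Dx R 1; rewrite -[1 + 1]/(2 : R); apply; lra.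
have dlz' : dl <= z by lra.
have dll : dl * ln 2 <= z.
  by apply: le_trans dlz'; rewrite -[X in _ <= X]mulr1 ler_wpM2l // (ltW dl0).
have tot : z + 3 * (dl * ln 2) + 3 * (J * dl) + z <= e * ln 2 by lra.
have := ler_wpM2r (ltW LR) tot.
have -> : (u - d + 3 * dl) * L%:R * ln 2 =
  (u - d) * ln 2 * L%:R + 3 * (dl * ln 2) * L%:R by ring.
have -> : J * (3 * dl * L%:R) = 3 * (J * dl) * L%:R by ring.
have -> : (u - d + e) * L%:R * ln 2 = (u - d) * ln 2 * L%:R + e * ln 2 * L%:R by ring.
rewrite !mulrDl; lra.
Unshelve. all: by end_near.
Qed.

Theorem theoremF (R : realType) (B : set nat)
    (B_pos : forall b, B b -> (0 < b)%N) :
  [/\ entropy R (orbit_closure (eta B)) >=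
        upper_density R (free_integers B)
        - upper_density R (free_integers (star B)),
      uniquely_ergodic R (orbit_closure (eta (star B))) ->
        has_density R (free_integers (star B)) /\
        entropy R (orbit_closure (eta B)) =
          upper_density R (free_integers B)
          - density R (free_integers (star B))
    & regular_toeplitz R (eta (star B)) ->
        uniquely_ergodic R (orbit_closure (eta (star B)))].
Proof.
split; first exact: entropy_lower.
- move=> /uniquely_ergodic_mean[d hd].
  have [hasd ->] := density_of_means hd; split => //.
  have ud : upper_density R (free_integers (star B)) = d.
    have [m [im _ mF]] := davenport_erdos R.
    rewrite -(hd m im) (free_star B_pos) mF //; exact: star_union_gt0.
  apply/eqP; rewrite eq_le entropy_upper //= -ud; exact: entropy_lower.
- exact: regular_toeplitz_uniquely_ergodic.
Qed.
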